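(* Let $c>\frac12$ and let $(\Delta_{n})$ be a sequence of positive numbers such that $\Delta_{n} n/\log n \to \infty$ as $n \to \infty$. Then there exist $\eta(c)>0$ and $n_{0}$ such that for all $n>n_{0}$, all integers $T> c N$ (where $N=2^n$), and all $a>0$, we have $$\frac1{\Delta_{n} T} \sum_{t =T+1}^{\lfloor (1+\Delta_{n}) T \rfloor} \mathbb{E}_{n} \Bigl( \frac{|V_{t}(N^{a})|}{N} \Bigr) \ge \eta(c) - a.$$ For $c>1$, one can take $\eta(c) = \tfrac12 \bigl(1 - \tfrac1c\bigr)$.
   Context: For $n\in\mathbb{N}$ let $G_n=(Q_n,E_n)$ be the hypercube graph: $Q_n=\{0,1\}^n$ has $N=2^n$ vertices, and $E_n$ consists of the pairs of vertices differing in exactly one coordinate, so $|E_n|=Nn/2$. Edges $e_1,e_2,e_3,\dots$ are chosen independently and uniformly at random from $E_n$; $\mathbb{P}_n$ and $\mathbb{E}_n$ denote the corresponding probability and expectation. For an edge $e$ let $\tau_e$ be the transposition of its two endvertices, and let $\sigma_t=\tau_{e_t}\circ\tau_{e_{t-1}}\circ\cdots\circ\tau_{e_1}$, a random permutation of $Q_n$. For a real number $\ell>0$, $V_t(\ell)\subset Q_n$ is the random set of vertices that belong to cycles of $\sigma_t$ of length greater than $\ell$. $\log$ denotes the logarithm to base $2$. *)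

(* Defs.v *)
From HB Require Import structures.
From mathcomp Require Import all_boot all_order all_algebra all_fingroup.
From mathcomp Require Import finmap.
From mathcomp Require Import all_classical all_reals all_analysis.
Import Order.TTheory GRing.Theory Num.Theory.
Import numFieldNormedType.Exports.

Set Implicit Arguments.
Unset Strict Implicit.
Unset Printing Implicit Defensive.

Local Open Scope classical_set_scope.
Local Open Scope ring_scope.

Definition log2 {R : realType} (x : R) : R := ln x / ln 2.

Notation cube n := {ffun 'I_n -> bool}.

Definition adjacent n (x y : cube n) : bool :=
  #|[set i | x i != y i]%SET| == 1%N.

Definition hypercube_edges n : {set {set cube n}} :=
  [set [set xy.1; xy.2]%SET | xy : cube n * cube n & adjacent xy.1 xy.2]%SET.

Notation edge n := {e : {set cube n} | e \in hypercube_edges n}.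

(* The endvertices of [e] are recovered by choice; by [edge_transpE] the result
   does not depend on the chosen order. *)
Definition edge_transp n (e : edge n) : {perm cube n} :=
  if [pick xy : cube n * cube n | val e == [set xy.1; xy.2]%SET] is Some xy
  then tperm xy.1 xy.2 else 1%g.

Lemma edge_transpE n (e : edge n) (x y : cube n) :
  val e = [set x; y]%SET -> edge_transp e = tperm x y.
Proof.
move=> ee; rewrite /edge_transp; case: pickP => [[u v] /= /eqP | /(_ (x, y))] /=;
  last by rewrite ee eqxx.
rewrite ee => /setP E.
have := E x; have := E y; have := E u; have := E v.
rewrite !inE !eqxx ?orbT /=.
move=> /orP[] /eqP-> /orP[] /eqP-> //; rewrite ?orbb.
- by move=> /esym/eqP->; rewrite tperm1.
- by move=> _ _; rewrite tpermC.
- by move=> _ /esym/eqP->; rewrite tperm1.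
Qed.

(* [w k] is the edge chosen at step [k + 1].  MathComp multiplies permutations
   from left to right, [(s * t)%g x = t (s x)], so the step composes with the
   new transposition on the left. *)
Fixpoint stirring_perm n (w : nat -> edge n) (t : nat) : {perm cube n} :=
  if t is t'.+1 then (stirring_perm w t' * edge_transp (w t'))%g else 1%g.

Definition long_cycle_vertices {R : realType} n (s : {perm cube n}) (l : R) :
  {set cube n} := [set x | l < #|porbit s x|%:R]%SET.

Section FiniteValuedRandomVariables.
Context {d : measure_display} {Omega : measurableType d} {R : realType}.
Variables (P : probability Omega R) (S : finType).
Local Open Scope ereal_scope.

Definition uniformly_distributed (X : Omega -> S) : Prop :=
  forall x : S, measurable (X @^-1` [set x]) /\
                P (X @^-1` [set x]) = (#|S|%:R^-1)%:E.

Definition mutually_independent (X : nat -> Omega -> S) : Prop :=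
  forall (J : {fset nat}) (A : nat -> set S),
    P (\bigcap_(j in [set` J]) (X j @^-1` A j)) =
    \prod_(j <- J) P (X j @^-1` A j).

Definition iid_uniform (X : nat -> Omega -> S) : Prop :=
  (forall k, uniformly_distributed (X k)) /\ mutually_independent X.

End FiniteValuedRandomVariables.

(* Main.v *)
Require Import Defs.
From HB Require Import structures.
From mathcomp Require Import all_boot all_order all_algebra all_fingroup.
From mathcomp Require Import finmap.
From mathcomp Require Import all_classical all_reals all_analysis.
From mathcomp Require Import measurable_realfun.
From mathcomp Require Import ring lra zify.
Import Order.TTheory GRing.Theory Num.Theory.
Import numFieldNormedType.Exports.

(** Multiplying a permutation by a transposition [(x y)] adds one cycle if [x] and
    [y] are in the same cycle, a split, and removes one otherwise. Hence, over a
    window of steps, twice the expected number of splits is the length of the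
    window plus the change in the expected number of cycles. Many splits force
    long cycles: by the edge-isoperimetric inequality ([isoperimetry]) a set [A]
    of vertices contains at most [#|A| * log2 #|A| / 2] edges, so the cycles of
    length at most [N ^ a], where [N = 2 ^ n], contain at most a proportion [a] of
    the edges, and a split has probability at most [a] plus the proportion of
    vertices in longer cycles ([average_split]). It remains to bound the splits
    from below, and for this to show that the number of cycles does not drop much.

    The cycles are compared with the clusters of the graph formed by the edges
    used so far. A cycle lies inside a cluster, so there are at least as many
    cycles as clusters. Conversely, apart from the at most [N / L] cycles of
    length at least [L], there are more cycles than clusters only because of
    fragments, short cycles which do not fill their cluster, and only a split
    that cuts off a piece shorter than [L] can create fragments
    ([nb_fragments_cons]). The ends of the edge of such a split are less than [L]
    steps apart on their cycle; isoperimetry, applied to arcs of cycles, shows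
    that this concerns a proportion [O(log L / n)] of the edges ([sum_close]).
    For [L = n] the excess of cycles at time [T] is [O(T * log n / n)], which is
    negligible against the length [Delta * T] of the window: this is the purpose
    of the assumption on [Delta].

    So, up to negligible terms, twice the number of splits in the window is at
    least the expected number of steps whose edge stays inside a cluster
    ([sum_split_prob]). The probability that an edge joins two clusters decreases
    in time, and the point is to bound it away from [1] at time [c * N].

    For [c > 1] this is counting: fewer than [N] junctions are possible, so their
    probability is at most [1 / c] after [c * N] steps, and a little less because
    the first steps are almost all junctions ([join_prob_counting]). This gives
    the explicit constant.

    For [c > 1 / 2] it is percolation beyond the threshold. At a time [c1 * N] with
    [1 / 2 < c1 < c], both ends of a random edge are in clusters of at least [L]
    vertices with a probability [q > 0] that does not depend on [L]
    ([prob_both_big]): count increasing open paths of length [L] starting from the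
    two ends, in the two halves of the cube separated by the direction of the
    edge; the mean degree is above [1], and the second moment of this number is
    bounded by a constant times the square of its mean. Now there are at most
    [N / L] such clusters, so only [N / L] later edges can join two of them; for
    [L] large most of the edges with both ends in large clusters have to stay
    inside one cluster ([join_prob_percolation]).

    All this is done with finite means over histories ([expect]);
    [expectation_history] transfers the result to the given random edges. *)

Local Open Scope ring_scope.
Set Implicit Arguments.
Unset Strict Implicit.
Unset Printing Implicit Defensive.

(** * Partitions and the fusion of two classes *)

Section Partition.
Context {R : realType} {V : finType}.
Implicit Types (p : V -> {set V}) (g : {set V} -> R) (x y z : V).

(** A partition is handled through the map sending each point to its class; the
    cycles of a permutation and the clusters of a graph are both of this form. *)
Definition partitioning p :=
  (forall z, z \in p z) /\ (forall y z, y \in p z -> p y = p z).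

Definition fuse p (B : {set V}) z : {set V} :=
  let U := \bigcup_(x in B) p x in if z \in U then U else p z.

(** The sum of [g] over the classes of [p]: weighting each point by the inverse
    of the size of its class turns it into a sum over points, so that two
    partitions can be compared point by point. *)
Definition class_sum g p : R := \sum_z g (p z) / #|p z|%:R.

Lemma bigcup_pair p x y :
  \bigcup_(z in [set x; y]%SET) p z = p x :|: p y.
Proof. by rewrite finset.bigcup_setU !big_set1. Qed.

Lemma partitioning_sym p x y : partitioning p -> (y \in p x) = (x \in p y).
Proof.
move=> [pr pe]; apply/idP/idP => h; first by rewrite (pe _ _ h).
by rewrite (pe _ _ h).
Qed.

Lemma partitioning_disjoint p x y :
  partitioning p -> y \notin p x -> [disjoint p x & p y].
Proof.
move=> [pr pe] h; apply/pred0P => z /=; apply/negP => /andP[zx zy].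
by move: h; rewrite -(pe _ _ zx) (pe _ _ zy) pr.
Qed.

Lemma mem_fuse p x y z : partitioning p ->
  z \in p x :|: p y -> fuse p [set x; y]%SET z = p x :|: p y.
Proof. by move=> _ h; rewrite /fuse bigcup_pair h. Qed.

Lemma notin_fuse p x y z :
  z \notin p x :|: p y -> fuse p [set x; y]%SET z = p z.
Proof. by move=> h; rewrite /fuse bigcup_pair (negbTE h). Qed.

Lemma sub_fuse p B z : partitioning p -> p z \subset fuse p B z.
Proof.
move=> [pr pe]; rewrite /fuse; case: ifP => // /finset.bigcupP[x xB zx].
by rewrite (pe _ _ zx); apply: (finset.bigcup_sup x).
Qed.

Lemma fuse_partitioning p x y :
  partitioning p -> partitioning (fuse p [set x; y]%SET).
Proof.
move=> [pr pe]; split=> [z|u z]; rewrite /fuse bigcup_pair.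
  by case: ifP => // _; rewrite pr.
case: ifP => [_ ->//|zU uz].
suff -> : (u \in p x :|: p y) = false by exact: pe.
apply/negP; rewrite inE => /orP[] h; move: zU; rewrite !inE.
  by rewrite -(pe _ _ h) (pe _ _ uz) pr.
by rewrite -(pe _ _ h) (pe _ _ uz) pr orbT.
Qed.

Lemma fuse_same p x y : partitioning p -> y \in p x ->
  fuse p [set x; y]%SET =1 p.
Proof.
move=> [pr pe] yx z; rewrite /fuse bigcup_pair (pe _ _ yx) finset.setUid.
by case: ifP => // /pe.
Qed.

Lemma sum_class g p x : partitioning p ->
  \sum_(z in p x) g (p z) / #|p z|%:R = g (p x).
Proof.
move=> [pr pe].
transitivity (\sum_(z in p x) g (p x) / #|p x|%:R).
  by apply: eq_bigr => z /pe ->.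
rewrite sumr_const -[X in X *+ _]mulr1 -mulrnAr -mulr_natr mul1r -mulrA.
rewrite mulVf ?mulr1//.
by rewrite pnatr_eq0 -lt0n; apply/card_gt0P; exists x.
Qed.

Lemma class_sum_split g p x y : partitioning p -> y \notin p x ->
  class_sum g p = g (p x) + g (p y)
    + \sum_(z | z \notin p x :|: p y) g (p z) / #|p z|%:R.
Proof.
move=> pp yx; rewrite /class_sum (bigID (mem (p x :|: p y)))/=; congr (_ + _).
rewrite -(sum_class g x pp) -(sum_class g y pp) -bigU/=.
  by apply: eq_bigl => z; rewrite !inE.
exact: partitioning_disjoint.
Qed.

Lemma class_sum_split1 g p x : partitioning p ->
  class_sum g p = g (p x) + \sum_(z | z \notin p x) g (p z) / #|p z|%:R.
Proof.
move=> pp; rewrite /class_sum (bigID (mem (p x)))/=; congr (_ + _).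
exact: sum_class.
Qed.

Lemma class_sum_fuse g p x y : partitioning p -> y \notin p x ->
  class_sum g (fuse p [set x; y]%SET)
  = class_sum g p + g (p x :|: p y) - g (p x) - g (p y).
Proof.
move=> pp yx; have pm := fuse_partitioning x y pp.
have mx : fuse p [set x; y]%SET x = p x :|: p y.
  by apply: mem_fuse => //; rewrite inE pp.1.
rewrite (class_sum_split1 _ x pm) mx (class_sum_split _ pp yx).
rewrite (eq_bigr (fun z => g (p z) / #|p z|%:R)); last first.
  by move=> z zU; rewrite notin_fuse.
by set s := \sum_(_ | _) _; lra.
Qed.

Lemma eq_class_sum g p p' : p =1 p' -> class_sum g p = class_sum g p'.
Proof. by move=> e; apply: eq_bigr => z _; rewrite e. Qed.

Lemma sum_class_average (f : V -> R) p : partitioning p ->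
  \sum_z f z = \sum_z (\sum_(y in p z) f y) / #|p z|%:R.
Proof.
move=> pp; under [RHS]eq_bigr do rewrite mulr_suml.
rewrite (exchange_big_dep predT)//=; apply: eq_bigr => y _.
rewrite (eq_bigl (mem (p y))); last first.
  by move=> z; rewrite (partitioning_sym _ _ pp).
by rewrite -[LHS](sum_class (fun=> f y) y pp).
Qed.

End Partition.

(** * Cycles of a permutation multiplied by a transposition *)

Section Cycles.
Context {V : finType}.
Implicit Types (s : {perm V}) (x y z : V).

Lemma porbit_partitioning s : partitioning (porbit s).
Proof.
split=> [z|y z]; first exact: porbit_id.
by rewrite -eq_porbit_mem => /eqP.
Qed.

Lemma porbit_subset_stable s (U : {set V}) z :
  (forall u, u \in U -> s u \in U) -> z \in U -> porbit s z \subset U.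
Proof.
move=> sU zU; apply/fintype.subsetP => u /porbitP[i ->].
elim: i => [|i IH]; first by rewrite expg0 perm1.
by rewrite expgSr permM; apply: sU.
Qed.

Lemma porbit_mul_tperm_out s x y z :
  z \notin porbit s x -> z \notin porbit s y ->
  porbit (s * tperm x y)%g z = porbit s z.
Proof.
move=> zx zy.
have it i : ((s * tperm x y) ^+ i)%g z = (s ^+ i)%g z.
  elim: i => [|i IH]; first by rewrite !expg0.
  rewrite !expgSr !permM IH tpermD//.
    apply: contraNneq zx => ->; rewrite -permM -expgSr.
    by rewrite porbit_sym mem_porbit.
  apply: contraNneq zy => ->; rewrite -permM -expgSr.
  by rewrite porbit_sym mem_porbit.
apply/setP => u; apply/porbitP/porbitP => -[i ->]; exists i; by rewrite it.
Qed.

(** The library counts the cycles of [tperm x y * s]; passing to inverses moves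
    the transposition to the right, where a new step of the walk appears. *)
Lemma card_porbits_mul_tperm s x y : x != y ->
  (#|porbits (s * tperm x y)%g| + (y \notin porbit s x).*2
   = #|porbits s| + 1)%N.
Proof.
move=> xy; have := porbits_mul_tperm s^-1%g x y.
rewrite /= porbitsV porbitV xy porbit_sym => <-; congr (#|_| + _)%N.
by rewrite -porbitsV invMg tpermV.
Qed.

(** The cycle count forces [x] and [y] into one cycle of the product, and this
    cycle is everything: away from it both permutations have the same cycles. *)
Lemma porbit_fuse s x y : y \notin porbit s x ->
  porbit (s * tperm x y)%g =1 fuse (porbit s) [set x; y]%SET.
Proof.
move=> yx; set s' := (s * _)%g.
have xy : x != y by apply: contraNneq yx => <-; exact: porbit_id.
have s'K : (s' * tperm x y)%g = s by rewrite /s' -mulgA tperm2 mulg1.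
have D : y \in porbit s' x.
  have := card_porbits_mul_tperm s xy; have := card_porbits_mul_tperm s' xy.
  rewrite s'K -/s' yx /=; case: (y \notin _) (negbNE (b := y \in porbit s' x)) => //=.
    lia.
  by move=> h _ _; apply: h.
have eD : porbit s' y = porbit s' x by apply/eqP; rewrite eq_porbit_mem.
set U := porbit s x :|: porbit s y.
have xU : x \in U by rewrite inE porbit_id.
have yU : y \in U by rewrite inE porbit_id orbT.
have sU u : u \in U -> s' u \in U.
  move=> uU; rewrite permM; case: tpermP => // _ _.
  move: uU; rewrite !inE => /orP[] /porbitP[i ->]; rewrite -permM -expgSr mem_porbit//.
  by rewrite orbT.
have eU : porbit s' x = U.
  apply/eqP; rewrite finset.eqEsubset porbit_subset_stable//=.
  apply/fintype.subsetP => z zU; apply/negPn/negP => zx.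
  have := @porbit_mul_tperm_out s' x y z zx; rewrite eD s'K => /(_ zx) e.
  by move: zU; rewrite inE => /orP[]; rewrite porbit_sym e porbit_sym ?eD (negbTE zx).
move=> z; rewrite /fuse bigcup_pair -/U; case: ifP => zU.
  by rewrite -eU; apply/eqP; rewrite eq_porbit_mem eU.
move: zU; rewrite inE => /negbT; rewrite negb_or => /andP[h1 h2].
exact: porbit_mul_tperm_out.
Qed.

(** A split is the reverse of a merger, because a transposition is an involution. *)
Lemma porbit_split s x y : x != y -> y \in porbit s x ->
  y \notin porbit (s * tperm x y)%g x
  /\ porbit s =1 fuse (porbit (s * tperm x y)%g) [set x; y]%SET.
Proof.
move=> xy yx; set s' := (s * _)%g.
have s'K : (s' * tperm x y)%g = s by rewrite /s' -mulgA tperm2 mulg1.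
have D : y \notin porbit s' x.
  have := card_porbits_mul_tperm s xy; have := card_porbits_mul_tperm s' xy.
  rewrite s'K -/s' yx /=; case: (y \notin _) => //=; lia.
by split=> // z; rewrite -[in LHS]s'K porbit_fuse.
Qed.

(** Until it first meets [y], the orbit of [x] under [s] is also its orbit under
    the product. Hence a split that cuts off a short cycle comes from two points
    that are close along the cycle of [s]. *)
Lemma split_arc s x y : x != y -> y \in porbit s x ->
  exists2 k, (k <= #|porbit (s * tperm x y)%g x|)%N & (s ^+ k)%g x = y.
Proof.
move=> xy yx; have [yx' _] := porbit_split xy yx.
set s' := (s * _)%g in yx' *; set k := #|porbit s' x|.
exists k => //.
(* the two orbits agree as long as the one of the product has not returned to [x] *)
have h j : (j < k)%N -> (s ^+ j)%g x = (s' ^+ j)%g x.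
  elim: j => [|j IH] jk; first by rewrite !expg0.
  have e : (s' ^+ j.+1)%g x = tperm x y ((s ^+ j.+1)%g x).
    by rewrite expgSr permM -IH ?(ltnW jk)// permM expgSr permM.
  case: tpermP e => // [ex e|ey e].
    by move: yx'; rewrite -e mem_porbit.
  have := uniq_traject_porbit s' x; rewrite -/k -(ltn_predK jk) /=.
  move=> /andP[+ _]; rewrite -[X in X \notin _]e => /negP[].
  apply/trajectP; exists j; first by rewrite -ltnS (ltn_predK jk).
  by rewrite -iterSr -permX.
have k0 : (0 < k)%N by rewrite /k (cardD1 x) porbit_id.
have e : tperm x y ((s ^+ k)%g x) = x.
  rewrite -(ltn_predK k0) expgSr permM h ?(ltn_predK k0)// -(permM s) -/s'.
  by rewrite -permM -expgSr (ltn_predK k0) permX iter_porbit.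
by rewrite -[LHS](tpermK x y) e tpermL.
Qed.

End Cycles.

(** * Means over independent uniform choices *)

Section Expectation.
Context {R : realType} {S : finType}.
Implicit Types (f g : S -> R) (F G : seq S -> R).

Definition average f : R := (\sum_s f s) / #|S|%:R.

(** The mean of [F] over independent uniform choices of [t] elements. Histories
    list the newest element first, so the recursion averages over the last
    choice before the earlier ones: this is conditioning on the past. *)
Fixpoint expect t F : R :=
  if t is t'.+1 then expect t' (fun w => average (fun s => F (s :: w)))
  else F [::].

Lemma averageD f g : average (fun s => f s + g s) = average f + average g.
Proof. by rewrite /average big_split mulrDl. Qed.

Lemma averageZ (k : R) f : average (fun s => k * f s) = k * average f.
Proof. by rewrite /average -mulr_sumr mulrA. Qed.

Lemma eq_average f g : f =1 g -> average f = average g.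
Proof. by move=> fg; congr (_ / _); apply: eq_bigr. Qed.

Lemma average_le f g : (forall s, f s <= g s) -> average f <= average g.
Proof. by move=> fg; rewrite /average ler_wpM2r ?invr_ge0// ler_sum. Qed.

Lemma average_ge0 f : (forall s, 0 <= f s) -> 0 <= average f.
Proof. by move=> f0; rewrite divr_ge0// sumr_ge0. Qed.

Lemma average_cst (k : R) : (0 < #|S|)%N -> average (fun=> k) = k.
Proof.
move=> S0; rewrite /average sumr_const -[k *+ _]mulr_natr mulfK//.
by rewrite pnatr_eq0 -lt0n.
Qed.

Lemma eq_expect t F G : (forall w, size w = t -> F w = G w) ->
  expect t F = expect t G.
Proof.
elim: t F G => [|t IH] F G FG /=; first exact: FG.
by apply: IH => w wt; apply: eq_average => s; apply: FG; rewrite /= wt.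
Qed.

Lemma expect_le t F G : (forall w, size w = t -> F w <= G w) ->
  expect t F <= expect t G.
Proof.
elim: t F G => [|t IH] F G FG /=; first exact: FG.
by apply: IH => w wt; apply: average_le => s; apply: FG; rewrite /= wt.
Qed.

Lemma expectD t F G :
  expect t (fun w => F w + G w) = expect t F + expect t G.
Proof.
elim: t F G => //= t IH F G; rewrite -IH.
by apply: eq_expect => w _; rewrite averageD.
Qed.

Lemma expectZ t (k : R) F : expect t (fun w => k * F w) = k * expect t F.
Proof.
elim: t F => //= t IH F; rewrite -IH.
by apply: eq_expect => w _; rewrite averageZ.
Qed.

Lemma expectB t F G :
  expect t (fun w => F w - G w) = expect t F - expect t G.
Proof.
rewrite (eq_expect (G := fun w => F w + -1 * G w)).
  by rewrite expectD expectZ mulN1r.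
by move=> w _; rewrite mulN1r.
Qed.

Lemma expect_cst t (k : R) : (0 < #|S|)%N -> expect t (fun=> k) = k.
Proof.
move=> S0; elim: t => //= t IH; rewrite -[RHS]IH.
by apply: eq_expect => w _; rewrite average_cst.
Qed.

Lemma expect_sum t (I : Type) (r : seq I) (P : pred I) (F : I -> seq S -> R) :
  expect t (fun w => \sum_(i <- r | P i) F i w)
  = \sum_(i <- r | P i) expect t (F i).
Proof.
elim: r => [|i r IH].
  rewrite big_nil -[RHS](mul0r (expect t (fun=> 0))) -expectZ.
  by apply: eq_expect => w _; rewrite big_nil mul0r.
rewrite big_cons -IH; case: ifP => Pi; last first.
  by apply: eq_expect => w _; rewrite big_cons Pi.
by rewrite -expectD; apply: eq_expect => w _; rewrite big_cons Pi.
Qed.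

Lemma expect_average t (F : S -> seq S -> R) :
  expect t (fun w => average (fun s => F s w))
  = average (fun s => expect t (F s)).
Proof.
rewrite /average -expect_sum mulrC -expectZ.
by apply: eq_expect => w _; rewrite mulrC.
Qed.

Lemma expect_ge0 t F : (forall w, size w = t -> 0 <= F w) -> 0 <= expect t F.
Proof.
move=> F0; rewrite -[0](mul0r (expect t (fun=> 0))) -expectZ.
by apply: expect_le => w wt; rewrite mul0r F0.
Qed.

(** The Cauchy--Schwarz bound on the probability that [X] does not vanish: expand
    the square of [u * X - I] and take [u = m1 / m2]. *)
Lemma second_moment t (X I : seq S -> R) (m1 m2 : R) :
  (forall w, 0 <= I w <= 1) -> (forall w, X w * I w = X w) ->
  0 < m1 -> m1 <= expect t X -> expect t (fun w => X w ^+ 2) <= m2 ->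
  m1 ^+ 2 / m2 <= expect t I.
Proof.
move=> I01 XI m1_gt0 hm1 hm2.
have key (u : R) : 0 <= u ->
    2 * u * expect t X - u ^+ 2 * expect t (fun w => X w ^+ 2) <= expect t I.
  move=> u0; rewrite -!expectZ -expectB; apply: expect_le => w _.
  rewrite -[X in 2 * u * X]XI.
  have := I01 w; have := sqr_ge0 (u * X w - I w); rewrite -subr_ge0; nra.
have m2_ge0 : 0 <= m2.
  by apply: le_trans hm2; apply: expect_ge0 => w _; exact: sqr_ge0.
have := key (m1 / m2) (divr_ge0 (ltW m1_gt0) m2_ge0).
have [->|m2_gt0] := eqVneq m2 0.
  move=> _; rewrite invr0 mulr0; apply: expect_ge0 => w _.
  by case/andP: (I01 w).
apply: le_trans.
have h1 : m1 / m2 * m1 <= m1 / m2 * expect t X.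
  by rewrite ler_wpM2l// divr_ge0// ltW.
have h2 : (m1 / m2) ^+ 2 * expect t (fun w => X w ^+ 2) <= (m1 / m2) ^+ 2 * m2.
  by rewrite ler_wpM2l// sqr_ge0.
have e : (m1 / m2) ^+ 2 * m2 = m1 ^+ 2 / m2 by field.
have e' : m1 / m2 * m1 = m1 ^+ 2 / m2 by field.
by rewrite e in h2; rewrite e' in h1; lra.
Qed.

End Expectation.

(** * Vertices and edges of the cube *)

Section Hypercube.
Context {n : nat}.
Implicit Types (x y : cube n) (i j : 'I_n).

Definition flip i x : cube n := [ffun j => x j (+) (j == i)].

Lemma flipK i : involutive (flip i).
Proof. by move=> x; apply/ffunP => j; rewrite !ffunE addbK. Qed.

Lemma flip_neq i x : x != flip i x.
Proof.
apply/eqP => /ffunP/(_ i); rewrite ffunE eqxx; by case: (x i).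
Qed.

Lemma flip_inj_dir i j x : flip i x = flip j x -> i = j.
Proof.
move=> /ffunP/(_ i); rewrite !ffunE eqxx => /addbI/esym; by move/eqP.
Qed.

Lemma edge_of_subproof i x : [set x; flip i x]%SET \in hypercube_edges n.
Proof.
apply/imsetP; exists (x, flip i x) => //; rewrite inE /= /Defs.adjacent.
rewrite (_ : [set j | x j != flip i x j]%SET = [set i]%SET) ?cards1//.
apply/setP => j; rewrite !inE ffunE; by case: (x j); case: (j == i).
Qed.

Definition edge_of x i : edge n :=
  exist (fun e : {set cube n} => e \in hypercube_edges n) _ (edge_of_subproof i x).

(** Edges are given as unordered pairs; all computations use the description by an
    endvertex and a direction, in which every edge appears exactly twice. *)
Lemma edgeP (e : edge n) : exists x i, e = edge_of x i.
Proof.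
have /imsetP[[x y]] := valP e; rewrite inE /= => /cards1P[i /setP ei] ee.
exists x, i; apply: val_inj; rewrite /= ee; congr [set _; _]%SET.
apply/ffunP => j; rewrite ffunE; have := ei j; rewrite !inE.
by case: (x j); case: (y j); case: (j == i).
Qed.

Lemma edge_of_flip x i : edge_of (flip i x) i = edge_of x i.
Proof. by apply: val_inj; rewrite /= flipK finset.setUC. Qed.

Lemma edge_of_inj x y i j : edge_of x i = edge_of y j ->
  i = j /\ (y = x \/ y = flip i x).
Proof.
move=> /(congr1 val)/= /setP E.
have := E y; have := E (flip j y); rewrite !inE !eqxx orbT /=.
have yj := flip_neq j y.
move=> /orP[/eqP h1|/eqP h1] /orP[/eqP h2|/eqP h2].
- by move: yj; rewrite h1 h2 eqxx.
- split; last by right.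
  by apply: (@flip_inj_dir _ _ y); rewrite h1 h2 flipK.
- split; last by left.
  by apply: (@flip_inj_dir _ _ y); rewrite h1 h2.
- by move: yj; rewrite h1 h2 eqxx.
Qed.

Lemma edge_transp_of x i : edge_transp (edge_of x i) = tperm x (flip i x).
Proof. exact: edge_transpE. Qed.

Lemma card_cube : #|{: cube n}| = (2 ^ n)%N.
Proof. by rewrite card_ffun card_bool card_ord. Qed.

Lemma sum_edges {R : comPzRingType} (F : edge n -> R) :
  \sum_x \sum_i F (edge_of x i) = 2 * \sum_e F e.
Proof.
rewrite pair_bigA /= (partition_big (fun p => edge_of p.1 p.2) predT)//=.
rewrite mulr_sumr; apply: eq_bigr => e _; have [x [i ->]] := edgeP e.
rewrite (eq_bigl (mem [set (x, i); (flip i x, i)]%SET)); last first.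
  move=> [y j]; rewrite !inE !xpair_eqE /=; apply/eqP/idP.
    by move=> /esym/edge_of_inj[<-] [] ->; rewrite !eqxx ?orbT.
  by case/orP => /andP[/eqP -> /eqP ->]; rewrite ?edge_of_flip.
rewrite big_setU1 ?inE ?xpair_eqE ?negb_and ?flip_neq//= big_set1 /=.
by rewrite edge_of_flip mulr2n mulrDl mul1r.
Qed.

Lemma card_edges : ((2 ^ n) * n = 2 * #|{: edge n}|)%N.
Proof.
have := sum_edges (fun=> 1 : rat); rewrite !sumr_const card_cube card_ord.
rewrite -mulrnA -natrM => /eqP; rewrite eqr_nat => /eqP. by rewrite mulnC.
Qed.

Lemma average_edges {R : realType} (F : edge n -> R) :
  average F = (\sum_x \sum_i F (edge_of x i)) / ((2 ^ n)%:R * n%:R).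
Proof.
rewrite sum_edges /average -natrM card_edges natrM invfM mulrACA.
by rewrite divff ?mul1r// pnatr_eq0.
Qed.

Lemma card_edges_gt0 : (0 < n)%N -> (0 < #|{: edge n}|)%N.
Proof.
by move=> n0; apply/card_gt0P; exists (edge_of [ffun=> false] (Ordinal n0)).
Qed.

End Hypercube.

(** * The edge-isoperimetric inequality *)

Section Isoperimetry.
Context {R : realType}.

Lemma ln2_gt0 : 0 < ln 2 :> R.
Proof. by rewrite ln_gt0// ltr1n. Qed.

Lemma log2_1 : log2 1 = 0 :> R.
Proof. by rewrite /log2 ln1 mul0r. Qed.

Lemma log2_2 : log2 2 = 1 :> R.
Proof. by rewrite /log2 divff// gt_eqF// ln2_gt0. Qed.

Lemma log2_le (x y : R) : 0 < x -> x <= y -> log2 x <= log2 y.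
Proof.
move=> x0 xy; rewrite /log2 ler_wpM2r ?invr_ge0 ?(ltW ln2_gt0)//.
by rewrite ler_ln ?posrE// (lt_le_trans x0).
Qed.

Lemma log2M (x y : R) : 0 < x -> 0 < y -> log2 (x * y) = log2 x + log2 y.
Proof. by move=> x0 y0; rewrite /log2 lnM ?posrE// mulrDl. Qed.

(** Concavity of the logarithm between [1] and [2]. *)
Lemma log2D1 (y : R) : 0 <= y <= 1 -> y <= log2 (1 + y).
Proof.
move=> /andP[y0 y1].
have := @concave_ln R (Itv01 y0 y1) 2 1 (ltr0Sn _ 1) ltr01.
rewrite !convRE /= /unstable.onem ln1 mulr0 addr0 => h.
rewrite /log2 ler_pdivlMr ?ln2_gt0//; apply: (le_trans h).
by rewrite (_ : _ + _ = 1 + y)//; lra.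
Qed.

(** For [a <= b] the difference of the two sides is at least
    [a * log2 (1 + b / a) + b * log2 (1 + a / b) - 2 * a], and the two logarithms
    are at least [1] and [a / b]. *)
Lemma entropy_split (a b m : R) : 0 < a -> 0 < b -> m <= a -> m <= b ->
  a * log2 a + b * log2 b + 2 * m <= (a + b) * log2 (a + b).
Proof.
wlog ab : a b / a <= b => [H a0 b0 ma mb|a0 b0 ma mb].
  have [ab|/ltW ba] := leP a b; first exact: H.
  by rewrite (addrC a b) (addrC (_ * log2 a)); apply: H.
have h1 : 1 <= log2 (1 + b / a).
  rewrite -[leLHS]log2_2; apply: log2_le => //.
  have : 1 <= b / a by rewrite ler_pdivlMr// mul1r.
  lra.
have h2 : a / b <= log2 (1 + a / b).
  by apply: log2D1; apply/andP; split; [rewrite divr_ge0// ltW|rewrite ler_pdivrMr ?mul1r].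
have e1 : log2 (a + b) = log2 a + log2 (1 + b / a).
  rewrite -log2M//; last by rewrite addr_gt0// divr_gt0.
  by congr log2; field; lra.
have e2 : log2 (a + b) = log2 b + log2 (1 + a / b).
  rewrite -log2M//; last by rewrite addr_gt0// divr_gt0.
  by congr log2; field; lra.
have h3 : a <= b * log2 (1 + a / b).
  by rewrite -ler_pdivrMl// mulrC.
have h4 : a <= a * log2 (1 + b / a) by rewrite -[X in X <= _]mulr1 ler_pM2l.
have -> : (a + b) * log2 (a + b) = a * (log2 a + log2 (1 + b / a))
    + b * (log2 b + log2 (1 + a / b)) by rewrite -e1 -e2 mulrDl.
lra.
Qed.

Context {n : nat}.
Implicit Types (A : {set cube n}).

(** Twice the number of edges inside [A]. *)
Definition internal_degree A : R :=
  \sum_(x in A) \sum_(i < n) (flip i x \in A)%:R.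

(** The edge-isoperimetric inequality of the cube. Cut [A] along a coordinate on
    which it is not constant: the edges across the cut match points of the two
    halves, so there are at most as many as points in the smaller half, and
    [entropy_split] pays for them. *)
Lemma isoperimetry A : internal_degree A <= #|A|%:R * log2 #|A|%:R.
Proof.
have [k] := ubnP #|A|; elim: k A => // k IH A Ak.
have [A1|A2] := leqP #|A| 1.
  have -> : internal_degree A = 0.
    apply: big1 => x xA; apply: big1 => i _.
    have /eqP -> : A == [set x]%SET.
      by rewrite eq_sym eqEcard finset.sub1set xA cards1.
    by rewrite inE eq_sym (negbTE (flip_neq _ _)).
  case: #|A| A1 => [|[|//]] _; first by rewrite mul0r.
  by rewrite log2_1 mulr0.
have /card_gt1P[x [y [xA yA]]] := A2.
(* induction on the size of [A] needs a coordinate for which both halves are nonempty *)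
have [i xyi|e] := pickP (fun i => x i != y i); last first.
  by case/eqP => //; apply/ffunP => i; have := e i; move/negbFE/eqP.
move=> _.
pose S b := [set z in A | z i == b]%SET.
have AS : A = S true :|: S false.
  by apply/setP => z; rewrite !inE; case: (z \in A); case: (z i).
have Sx : x \in S (x i) by rewrite inE xA eqxx.
have Sy : y \in S (~~ x i).
  by rewrite inE yA; case: (x i) (y i) xyi => -[].
have Sgt0 b : (0 < #|S b|)%N.
  apply/card_gt0P; have [<-|/negPf xb] := eqVneq (x i) b; first by exists x.
  by exists y; move: xb Sy; case: (x i) (b) => -[].
have dS : [disjoint S true & S false].
  by apply/pred0P => z /=; rewrite !inE; case: (z i); rewrite ?andbF.
have cA : #|A| = (#|S true| + #|S false|)%N.
  by rewrite [in LHS]AS cardsU finset.disjoint_setI0// cards0 subn0.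
have Slt b : (#|S b| < k)%N.
  by have := Sgt0 (~~ b); move: Ak; rewrite cA; case: b => /=; lia.
pose m b : R := \sum_(z in S b) (flip i z \in S (~~ b))%:R.
have mE b : m b = m (~~ b).
  rewrite /m negbK big_mkcond [RHS]big_mkcond/= (reindex_inj (inv_inj (flipK i))).
  apply: eq_bigr => z _; rewrite flipK.
  by case: (flip i z \in _); case: (z \in _).
have mle b : m b <= #|S b|%:R.
  rewrite -sumr_const ler_sum// => z _; by case: (_ \in _).
have key b : \sum_(z in S b) \sum_(j < n) (flip j z \in A)%:R
    = internal_degree (S b) + m b.
  rewrite -big_split/=; apply: eq_bigr => z zS.
  rewrite [LHS](bigD1 i)//= [in RHS](bigD1 i)//=.
  have zb : z i = b by move: zS; rewrite inE => /andP[_ /eqP].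
  rewrite !inE !ffunE eqxx zb addbT eqxx andbT.
  rewrite (_ : ~~ b == b = false) ?andbF; last by case: (b).
  rewrite add0r addrC; congr (_ + _); apply: eq_bigr => j ji.
  by rewrite !inE !ffunE [i == j]eq_sym (negbTE ji) addbF zb eqxx andbT.
have -> : internal_degree A
    = internal_degree (S true) + internal_degree (S false) + 2 * m true.
  rewrite {1}/internal_degree [in X in _ = X + _]addrC.
  rewrite (eq_bigl [predU S true & S false]); last first.
    by move=> z; rewrite [in LHS]AS !inE.
  by rewrite bigU//= !key -(mE true); lra.
have mf : m true <= #|S false|%:R by rewrite mE; exact: (mle false).
have pos b : (0 : R) < #|S b|%:R by rewrite ltr0n.
have := entropy_split (pos true) (pos false) (mle true) mf.
have := IH _ (Slt true); have := IH _ (Slt false).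
by rewrite cA natrD; lra.
Qed.

End Isoperimetry.

(** * Cycles and percolation clusters along a history *)

Section Dynamics.
Context {n : nat}.
Implicit Types (x y z : cube n) (i : 'I_n) (e : edge n) (w : seq (edge n)).
Implicit Types (s : {perm cube n}) (p : cube n -> {set cube n}).

Fixpoint stir w : {perm cube n} :=
  if w is e :: w' then (stir w' * edge_transp e)%g else 1%g.

Fixpoint cluster_of w : cube n -> {set cube n} :=
  if w is e :: w' then fuse (cluster_of w') (val e) else fun z => [set z]%SET.

Definition joined p e : bool := [forall x in val e, val e \subset p x].

Lemma joined_of p x i : partitioning p ->
  joined p (edge_of x i) = (flip i x \in p x).
Proof.
move=> pp; apply/forall_inP/idP => [/(_ x)|h z]; rewrite /= !inE.
  rewrite eqxx => /(_ isT) /fintype.subsetP; apply; by rewrite !inE eqxx orbT.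
rewrite finset.subUset !finset.sub1set => /orP[] /eqP ->; rewrite ?pp.1 ?h//.
by rewrite (partitioning_sym _ _ pp) h.
Qed.

Lemma cluster_partitioning w : partitioning (cluster_of w).
Proof.
elim: w => [|e w IH] /=; last first.
  by have [x [i ->]] := edgeP e; apply: fuse_partitioning.
by split=> [z|y z]; rewrite inE// => /eqP ->.
Qed.

Lemma sub_cluster_cons e w z : cluster_of w z \subset cluster_of (e :: w) z.
Proof. exact/sub_fuse/cluster_partitioning. Qed.

Lemma cluster_cons_joined e w : joined (cluster_of w) e ->
  cluster_of (e :: w) =1 cluster_of w.
Proof.
have [x [i ->]] := edgeP e; have pp := cluster_partitioning w.
by rewrite joined_of//; apply: fuse_same.
Qed.

Lemma joined_cluster_cons e e' w :
  joined (cluster_of w) e -> joined (cluster_of (e' :: w)) e.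
Proof.
have [x [i ->]] := edgeP e; rewrite !joined_of; try exact: cluster_partitioning.
exact/fintype.subsetP/sub_cluster_cons.
Qed.

Lemma edge_sub_cluster_cons e w : joined (cluster_of (e :: w)) e.
Proof.
have [x [i ->]] := edgeP e; rewrite joined_of; last exact: cluster_partitioning.
have pp := cluster_partitioning w.
rewrite /= mem_fuse//; rewrite !inE ?pp.1 ?orbT//.
Qed.

(** Each step moves a point along an edge of its own cluster. *)
Lemma porbit_sub_cluster w z : porbit (stir w) z \subset cluster_of w z.
Proof.
have pp := cluster_partitioning w.
suff st u : stir w u \in cluster_of w u.
  apply: porbit_subset_stable; last exact: pp.1.
  by move=> u /pp.2 <-.
elim: w {pp z} u => [|e w IH] u; first by rewrite perm1 inE.
have pp := cluster_partitioning (e :: w).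
have h : stir w u \in cluster_of (e :: w) u.
  exact: fintype.subsetP (sub_cluster_cons e w u) _ (IH u).
rewrite [stir _]/= permM; have [x [i ee]] := edgeP e.
have := edge_sub_cluster_cons e w; rewrite {2}ee joined_of// => j.
rewrite {1}ee edge_transp_of -(pp.2 _ _ h).
case: tpermP => [->//|->|_ _]; last exact: pp.1.
by rewrite (partitioning_sym _ _ pp).
Qed.

Lemma joined_porbit_cluster w e :
  joined (porbit (stir w)) e -> joined (cluster_of w) e.
Proof.
have [x [i ->]] := edgeP e; rewrite !joined_of.
- exact/fintype.subsetP/porbit_sub_cluster.
- exact: cluster_partitioning.
- exact: porbit_partitioning.
Qed.

Section Potentials.
Context {R : realType}.

Definition nb_clusters w : R := class_sum (fun=> 1) (cluster_of w).
Definition nb_cycles s : R := class_sum (fun=> 1) (porbit s).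

Lemma nb_clusters_nil : nb_clusters [::] = (2 ^ n)%:R.
Proof.
rewrite /nb_clusters /class_sum; under eq_bigr do rewrite cards1 divr1.
by rewrite sumr_const card_cube.
Qed.

Lemma nb_clusters_cons e w :
  nb_clusters (e :: w) = nb_clusters w - (~~ joined (cluster_of w) e)%:R.
Proof.
have [/cluster_cons_joined h|] := boolP (joined _ _).
  by rewrite subr0; apply: eq_class_sum.
have pp := cluster_partitioning w.
have [x [i ->]] := edgeP e; rewrite joined_of// => h.
by rewrite /nb_clusters /= class_sum_fuse//=; lra.
Qed.

Lemma nb_cycles_cons e w :
  nb_cycles (stir (e :: w))
  = nb_cycles (stir w) + 2 * (joined (porbit (stir w)) e)%:R - 1.
Proof.
have [x [i ->]] := edgeP e; rewrite joined_of; last exact: porbit_partitioning.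
rewrite /= edge_transp_of; set s := stir w.
have xf := flip_neq i x.
have [h|h] := boolP (_ \in _).
  have [h1 h2] := porbit_split xf h.
  rewrite /nb_cycles (eq_class_sum _ h2) class_sum_fuse//=; first by lra.
  exact: porbit_partitioning.
rewrite /nb_cycles (eq_class_sum _ (porbit_fuse h)) class_sum_fuse//=; first by lra.
exact: porbit_partitioning.
Qed.

(** Point by point, since the cycle of a point is contained in its cluster. *)
Lemma nb_clusters_le_cycles w : nb_clusters w <= nb_cycles (stir w).
Proof.
apply: ler_sum => z _; rewrite !mul1r lef_pV2 ?posrE ?ltr0n; last 2 first.
- by apply/card_gt0P; exists z; exact: (cluster_partitioning w).1.
- by apply/card_gt0P; exists z; exact: porbit_id.
by rewrite ler_nat subset_leq_card// porbit_sub_cluster.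
Qed.

Lemma nb_clusters_ge0 w : 0 <= nb_clusters w.
Proof. by apply: sumr_ge0 => z _; rewrite mul1r invr_ge0. Qed.

Definition is_cluster w (A : {set cube n}) := [exists z, cluster_of w z == A].

(** Fragments are what makes the cycles more numerous than the clusters, up to the
    long cycles, which are few. *)
Definition fragment L w (A : {set cube n}) : R :=
  ((#|A| < L)%N && ~~ is_cluster w A)%:R.

Definition nb_fragments L w : R := class_sum (fragment L w) (porbit (stir w)).

Definition short_split L w e : bool :=
  joined (porbit (stir w)) e
  && [exists x in val e, (#|porbit (stir (e :: w)) x| < L)%N].

Lemma fragment_ge0 L w A : 0 <= fragment L w A.
Proof. exact: ler0n. Qed.

Lemma nb_fragments_nil L : nb_fragments L [::] = 0.
Proof.
apply: big1 => z _; rewrite /fragment (_ : is_cluster _ _) ?andbF ?mul0r//.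
apply/existsP; exists z; rewrite /= finset.eqEsubset finset.sub1set porbit_id /=.
exact: porbit_sub_cluster [::] z.
Qed.

(** A merger never creates a fragment: if both cycles filled their clusters, their
    union fills the new cluster, and if one of them did not, it was already a
    fragment whenever the union is short. A split changes no cluster and adds at
    most its two pieces. *)
Lemma nb_fragments_cons L w e :
  nb_fragments L (e :: w) <= nb_fragments L w + 2 * (short_split L w e)%:R.
Proof.
have [x [i ee]] := edgeP e; set y := flip i x in ee.
have xy : x != y := flip_neq i x.
have po := porbit_partitioning (stir w).
have pc := cluster_partitioning w.
have eS : stir (e :: w) = (stir w * tperm x y)%g by rewrite ee /= edge_transp_of.
rewrite /short_split; set js := joined _ _.
have jsE : js = (y \in porbit (stir w) x) by rewrite /js ee joined_of.
case: (boolP js) => [j|j].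
  have jc : joined (cluster_of w) e by apply: joined_porbit_cluster.
  (* split: both endvertices are in one cycle, hence in one
     cluster, and the clusters do not change *)
  have fE A : fragment L (e :: w) A = fragment L w A.
    rewrite /fragment /is_cluster; congr ((_ && ~~ _)%:R); apply: eq_existsb => z.
    by rewrite cluster_cons_joined.
  rewrite jsE in j; have [h1 h2] := porbit_split xy j; rewrite -eS in h1 h2.
  rewrite /nb_fragments (eq_class_sum _ h2).
  have po' := porbit_partitioning (stir (e :: w)).
  rewrite class_sum_fuse//.
  have -> : class_sum (fragment L (e :: w)) (porbit (stir (e :: w)))
          = class_sum (fragment L w) (porbit (stir (e :: w))).
    by apply: eq_bigr => z _; rewrite fE.
  have := fragment_ge0 L w (porbit (stir (e :: w)) x :|: porbit (stir (e :: w)) y).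
  have bd z : z \in val e -> fragment L w (porbit (stir (e :: w)) z)
      <= [exists u in val e, (#|porbit (stir (e :: w)) u| < L)%N]%:R.
    move=> ze; rewrite /fragment; case: ltnP => //= sz.
    rewrite (_ : [exists u in _, _]); first by case: (is_cluster _ _).
    by apply/exists_inP; exists z.
  have bx := bd x; have by_ := bd y; rewrite ee !inE !eqxx orbT in bx by_.
  have := bx isT; have := by_ isT; rewrite -ee /=; clear; lra.
rewrite mulr0 addr0; rewrite jsE in j.
set O := porbit (stir w).
(* merger: a cycle away from the new one keeps filling its
   cluster, or keeps missing a part of it *)
have out z : z \notin O x :|: O y -> fragment L (e :: w) (O z) <= fragment L w (O z).
  move=> zO; rewrite /fragment; case: (ltnP _ _) => //= _.
  rewrite ler_nat; case: (boolP (is_cluster w _)) => [|_]; last by case: is_cluster.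
  move=> /existsP[u /eqP eu].
  rewrite (_ : is_cluster _ _)//; apply/existsP; exists u => /=.
  have xu v : v \in [set x; y]%SET -> v \notin cluster_of w u.
    rewrite eu; rewrite !inE negb_or in zO; case/andP: zO => zx zy.
    by rewrite !inE => /orP[] /eqP ->; rewrite porbit_sym.
  rewrite ee /= notin_fuse ?eu// inE negb_or.
  rewrite !(partitioning_sym _ u pc) !xu// !inE ?eqxx ?orbT//.
have inn : fragment L (e :: w) (O x :|: O y)
    <= fragment L w (O x) + fragment L w (O y).
  rewrite {1}/fragment; case: ltnP => [sU|_]; last by rewrite addr_ge0 ?fragment_ge0.
  case: (boolP (is_cluster _ _)) => [_|ncU]; first by rewrite addr_ge0 ?fragment_ge0.
  have sx : (#|O x| < L)%N.
    by apply: leq_ltn_trans sU; rewrite subset_leq_card// finset.subsetUl.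
  have sy : (#|O y| < L)%N.
    by apply: leq_ltn_trans sU; rewrite subset_leq_card// finset.subsetUr.
  rewrite /fragment sx sy /= -natrD ler_nat.
  case: (boolP (is_cluster w (O x))) => //; case: (boolP (is_cluster w (O y))) => //.
  move=> /existsP[v /eqP ev] /existsP[u /eqP eu]; exfalso; move/negP: ncU; apply.
  have cx : cluster_of w x = O x.
    by rewrite -eu; apply: pc.2; rewrite eu /O porbit_id.
  have cy : cluster_of w y = O y.
    by rewrite -ev; apply: pc.2; rewrite ev /O porbit_id.
  apply/existsP; exists x; rewrite ee /= mem_fuse ?cx ?cy//.
  by rewrite inE /O porbit_id.
rewrite /nb_fragments eS (eq_class_sum _ (porbit_fuse j)) class_sum_fuse//.
rewrite !(class_sum_split _ po j) -/O.
suff : \sum_(z | z \notin O x :|: O y) fragment L (e :: w) (O z) / #|O z|%:R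
    <= \sum_(z | z \notin O x :|: O y) fragment L w (O z) / #|O z|%:R by lra.
by apply: ler_sum => z zO; rewrite ler_wpM2r ?invr_ge0// out.
Qed.

(** A point in a cycle of length at least [L] contributes at most [1 / L]; in a
    shorter cycle it is counted either by its cluster or by a fragment. *)
Lemma nb_cycles_le L w : (0 < L)%N ->
  nb_cycles (stir w) <= nb_clusters w + (2 ^ n)%:R / L%:R + nb_fragments L w.
Proof.
move=> L0.
have -> : (2 ^ n)%:R / L%:R = \sum_(z : cube n) L%:R^-1 :> R.
  by rewrite sumr_const card_cube -[RHS]mulr_natl.
rewrite -!big_split/=; apply: ler_sum => z _; rewrite !mul1r /fragment.
have pc := cluster_partitioning w.
have i0 (k : nat) : 0 <= k%:R^-1 :> R by rewrite invr_ge0.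
have [sz|sz] := ltnP #|_| L => /=; last first.
  rewrite mul0r addr0; apply: (@le_trans _ _ L%:R^-1); last by rewrite lerDr.
  by rewrite lef_pV2 ?posrE ?ltr0n ?ler_nat// (leq_trans L0).
case: (boolP (is_cluster _ _)) => [/existsP[u /eqP eu]|_] /=; last first.
  by rewrite mul1r lerDr addr_ge0.
have -> : cluster_of w z = porbit (stir w) z.
  by rewrite -eu; apply: pc.2; rewrite eu porbit_id.
by rewrite mul0r addr0 lerDl.
Qed.

End Potentials.
End Dynamics.

(** * Edges inside short arcs and inside short cycles *)

Section Arcs.
Context {V : finType}.
Implicit Types (s : {perm V}) (x : V).

Definition arc s k x : {set V} := [set (s ^+ (j : nat))%g x | j : 'I_k]%SET.

Lemma arcP s k x z :
  reflect (exists2 j, (j < k)%N & z = (s ^+ j)%g x) (z \in arc s k x).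
Proof.
apply: (iffP imsetP) => [[j _ ->]|[j jk ->]]; first by exists (j : nat).
by exists (Ordinal jk).
Qed.

Lemma card_arc_shift s k m x : #|arc s k ((s ^+ m)%g x)| = #|arc s k x|.
Proof.
rewrite -[RHS](card_imset _ (@perm_inj _ (s ^+ m)%g)); congr #|pred_of_set _|.
apply/setP => z; apply/arcP/imsetP => [[j jk ->]|[u /arcP[j jk ->] ->]].
  exists ((s ^+ j)%g x); first by apply/arcP; exists j.
  by rewrite -!permM -!expgD addnC.
by exists j => //; rewrite -!permM -!expgD addnC.
Qed.

(** An arc of length [2 * k] is covered by two arcs of length [k], which are
    translates of each other along the cycle. *)
Lemma card_arc_double s k x : (#|arc s (k + k) x| <= 2 * #|arc s k x|)%N.
Proof.
rewrite mul2n -addnn -[in X in (_ <= _ + X)%N](card_arc_shift s k k x).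
apply: leq_trans (leq_card_setU _ _); apply: subset_leq_card.
apply/fintype.subsetP => z /arcP[j jk ->]; rewrite inE.
have [jk'|kj] := ltnP j k; apply/orP; [left|right]; apply/arcP.
  by exists j.
exists (j - k)%N; first lia.
by rewrite -permM -expgD subnKC.
Qed.

Lemma card_arc_le s k x : (#|arc s k x| <= k)%N.
Proof. by apply: leq_trans (leq_imset_card _ _) _; rewrite cardT size_enum_ord. Qed.

End Arcs.

Section Counting.
Context {R : realType} {n : nat}.
Implicit Types (x y z : cube n) (i : 'I_n) (s : {perm cube n}).
Implicit Types (w : seq (edge n)).

Definition close s L x i : bool :=
  [exists k : 'I_L, (s ^+ (k : nat))%g x == flip i x].

(** By isoperimetry the mean internal degree of an arc of length [2 * L] is at most
    [log2 (2 * L)]. Summing over the starting points of the arcs with the weight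
    [1 / #|B x|], a close pair is counted with weight at least [1 / 2]: it lies in
    the arcs started at the last [L] points up to its first end, and by [card_arc_double]
    this holds also in cycles shorter than the arcs. *)
Lemma sum_close s L : (0 < L)%N ->
  \sum_x \sum_i (close s L x i)%:R <= 2 * (2 ^ n)%:R * log2 (2 * L)%:R :> R.
Proof.
move=> L0; pose B := arc s (L + L).
have B0 x : (0 < #|B x|)%N.
  by apply/card_gt0P; exists x; apply/arcP; exists 0%N; rewrite ?perm1 ?addn_gt0 ?L0.
have upper : \sum_x internal_degree (B x) / #|B x|%:R
    <= (2 ^ n)%:R * log2 (2 * L)%:R :> R.
  have -> : (2 ^ n)%:R * log2 (2 * L)%:R = \sum_(x : cube n) log2 (2 * L)%:R :> R.
    by rewrite sumr_const card_cube mulr_natl.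
  apply: ler_sum => x _; rewrite ler_pdivrMr ?ltr0n//.
  apply: le_trans (isoperimetry _) _; rewrite mulrC ler_wpM2r//.
  by rewrite log2_le ?ltr0n// ler_nat mul2n -addnn card_arc_le.
have -> : 2 * (2 ^ n)%:R * log2 (2 * L)%:R = 2 * ((2 ^ n)%:R * log2 (2 * L)%:R) :> R.
  by rewrite mulrA.
apply: le_trans (ler_wpM2l _ upper) => //.
have -> : \sum_x internal_degree (B x) / #|B x|%:R
  = \sum_z \sum_i \sum_(x | (z \in B x) && (flip i z \in B x)) #|B x|%:R^-1 :> R.
  rewrite /internal_degree; under eq_bigr do rewrite mulr_suml big_mkcond.
  rewrite exchange_big; apply: eq_bigr => z _.
  under eq_bigr => x _ do rewrite mulr_suml.
  rewrite [LHS](_ : _ = \sum_x \sum_i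
     (if (z \in B x) && (flip i z \in B x) then #|B x|%:R^-1 else 0)); last first.
    apply: eq_bigr => x _; case: (z \in B x) => /=.
      by apply: eq_bigr => i _; case: (_ \in _); rewrite ?mul1r ?mul0r.
    by rewrite big1.
  by rewrite exchange_big; apply: eq_bigr => i _; rewrite -big_mkcond.
rewrite mulr_sumr; apply: ler_sum => z _; rewrite mulr_sumr; apply: ler_sum => i _.
have [/existsP[k /eqP zk]|_] := boolP (close s L z i); last first.
  by rewrite mulr_ge0// sumr_ge0// => x _; rewrite invr_ge0.
(* the arc of length [L] from [u] ends at [z]; every arc [B x] started on
   it contains the pair *)
pose u := ((s^-1) ^+ L.-1)%g z.
have uz : (s ^+ L.-1)%g u = z by rewrite /u expgVn permKV.
have memB x : x \in arc s L u -> (z \in B x) && (flip i z \in B x).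
  move=> /arcP[j jL ->]; have jL' : (j <= L.-1)%N by lia.
  have zx : z = (s ^+ (L.-1 - j))%g ((s ^+ j)%g u).
    by rewrite -permM -expgD subnKC.
  apply/andP; split; apply/arcP; first by exists (L.-1 - j)%N => //; lia.
  exists ((L.-1 - j) + k)%N; first by have := ltn_ord k; lia.
  by rewrite expgD permM -zx.
have A0 : (0 < #|arc s L u|)%N.
  by apply/card_gt0P; exists u; apply/arcP; exists 0%N; rewrite ?perm1.
have : \sum_(x in arc s L u) (2 * #|arc s L u|)%:R^-1
    <= \sum_(x | (z \in B x) && (flip i z \in B x)) #|B x|%:R^-1 :> R.
  rewrite [leRHS](bigID (mem (arc s L u)))/= -[leLHS]addr0 lerD//; last first.
    by rewrite sumr_ge0// => x _; rewrite invr_ge0.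
  rewrite [leRHS](eq_bigl (mem (arc s L u))); last first.
    by move=> x /=; case: (boolP (x \in arc _ _ _)) => [/memB ->|]; rewrite ?andbF.
  apply: ler_sum => x /arcP[j jL ->]; rewrite lef_pV2 ?posrE ?ltr0n//; last first.
    by rewrite muln_gt0.
  by rewrite ler_nat -(card_arc_shift s L j u) card_arc_double.
rewrite sumr_const -[X in X <= _]mulr_natl natrM invfM mulrCA divff ?mulr1.
  by move=> h; have := ler_wpM2l (ler0n R 2) h; rewrite divff ?pnatr_eq0.
by rewrite pnatr_eq0 -lt0n.
Qed.

Lemma short_split_close L w x i : short_split L w (edge_of x i) ->
  close (stir w) L x i || close (stir w) L (flip i x) i.
Proof.
have key y j : edge_of y j = edge_of x i -> flip j y \in porbit (stir w) y ->
    (#|porbit (stir (edge_of x i :: w)) y| < L)%N -> close (stir w) L y j.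
  move=> <- h; rewrite [stir _]/= edge_transp_of => sy.
  have [k kle kE] := split_arc (flip_neq j y) h.
  by apply/existsP; exists (Ordinal (leq_ltn_trans kle sy)); apply/eqP.
rewrite /short_split joined_of; last exact: porbit_partitioning.
move=> /andP[j /exists_inP[y]]; rewrite !inE => /orP[] /eqP -> h; apply/orP.
  by left; apply: key.
right; apply: key => //; first exact: edge_of_flip.
by rewrite flipK porbit_sym.
Qed.

(** The factor [4] is twice that of [sum_close], because each endvertex of the edge
    may play the role of the first point of the arc. *)
Lemma average_short_split L w : (0 < L)%N -> (0 < n)%N ->
  average (fun e => (short_split L w e)%:R) <= 4 * log2 (2 * L)%:R / n%:R :> R.
Proof.
move=> L0 n0; rewrite average_edges; set s := stir w.
have N0 : (0 : R) < (2 ^ n)%:R by rewrite ltr0n expn_gt0.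
have h : \sum_x \sum_i (short_split L w (edge_of x i))%:R
    <= 4 * (2 ^ n)%:R * log2 (2 * L)%:R :> R.
  apply: (@le_trans _ _ (2 * \sum_x \sum_i (close s L x i)%:R)); last first.
    by have := sum_close s L0; lra.
  have -> : 2 * \sum_x \sum_i (close s L x i)%:R =
      \sum_x \sum_i ((close s L x i)%:R + (close s L (flip i x) i)%:R) :> R.
    under [RHS]eq_bigr do rewrite big_split/=.
    rewrite big_split/= [X in _ = _ + X]exchange_big/=.
    rewrite [X in _ = _ + X](_ : _ = \sum_i \sum_x (close s L x i)%:R); last first.
      by apply: eq_bigr => i _; rewrite [RHS](reindex_inj (inv_inj (flipK i))).
    by rewrite [X in _ = _ + X]exchange_big/=; lra.
  apply: ler_sum => x _; apply: ler_sum => i _.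
  case: (boolP (short_split _ _ _)) => [/short_split_close|_]; last first.
    by rewrite addr_ge0.
  by rewrite -natrD ler_nat -/s => /orP[] ->; rewrite ?addn1 ?leq_addr ?leq_addl//.
have n0R : (0 : R) < n%:R by rewrite ltr0n.
rewrite ler_pdivrMr ?mulr_gt0//; apply: le_trans h _.
rewrite le_eqVlt; apply/orP; left; apply/eqP.
by field; rewrite gt_eqF.
Qed.

(** An edge inside a long cycle starts at a vertex of the long cycles; by
    isoperimetry the mean internal degree of a cycle of length at most [l] is at
    most [log2 l], among the [n] edges at each vertex. *)
Lemma average_split s (l : R) : 1 <= l -> (0 < n)%N ->
  average (fun e => (joined (porbit s) e)%:R)
  <= #|long_cycle_vertices s l|%:R / (2 ^ n)%:R + log2 l / n%:R :> R.
Proof.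
move=> l1 n0; rewrite average_edges.
have N0 : (0 : R) < (2 ^ n)%:R by rewrite ltr0n expn_gt0.
have n0R : (0 : R) < n%:R by rewrite ltr0n.
have po := porbit_partitioning s.
have ll0 : 0 <= log2 l by rewrite -(@log2_1 R) log2_le.
have h : \sum_x \sum_i (joined (porbit s) (edge_of x i))%:R
    <= n%:R * #|long_cycle_vertices s l|%:R + (2 ^ n)%:R * log2 l :> R.
  under eq_bigr do under eq_bigr do rewrite joined_of//.
  rewrite (bigID (mem (long_cycle_vertices s l)))/= lerD//.
    rewrite mulr_natr -sumr_const ler_sum// => x _.
    have <- : \sum_(i < n) 1 = n%:R :> R by rewrite sumr_const card_ord.
    by apply: ler_sum => i _; case: (_ \in _).
  rewrite big_mkcond/= (sum_class_average _ po).
  have -> : (2 ^ n)%:R * log2 l = \sum_(x : cube n) log2 l :> R.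
    by rewrite sumr_const card_cube mulr_natl.
  apply: ler_sum => x _.
  have x0 : (0 < #|porbit s x|)%N by apply/card_gt0P; exists x; exact: porbit_id.
  rewrite ler_pdivrMr ?ltr0n//.
  have [lx|xl] := boolP (x \in long_cycle_vertices s l).
    rewrite big1 ?(mulr_ge0 ll0)// => y yx; rewrite ifF//; apply/negbF.
    by move: lx; rewrite !inE (po.2 _ _ yx).
  have -> : \sum_(y in porbit s x) (if y \notin long_cycle_vertices s l
      then \sum_(i < n) (flip i y \in porbit s y)%:R else 0)
    = internal_degree (porbit s x) :> R.
    apply: eq_bigr => y yx; rewrite (po.2 _ _ yx) ifT//.
    by move: xl; rewrite !inE (po.2 _ _ yx).
  apply: le_trans (isoperimetry _) _; rewrite mulrC ler_wpM2r//.
  rewrite log2_le ?ltr0n//.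
  by move: xl; rewrite inE -leNgt.
rewrite ler_pdivrMr ?mulr_gt0//; apply: le_trans h _.
rewrite le_eqVlt; apply/orP; left; apply/eqP.
by field; rewrite !gt_eqF.
Qed.

End Counting.

(** * The probability that given elements are all drawn *)

Section PowerInequalities.
Context {R : realFieldType}.

Lemma one_sub_expn_ge (x : R) k : 0 <= x <= 1 -> 1 - k%:R * x <= (1 - x) ^+ k.
Proof.
move=> /andP[x0 x1]; elim: k => [|k IH]; first by rewrite expr0 mul0r subr0.
have k0 : (0 : R) <= k%:R by [].
have h : (1 - x) * (1 - k%:R * x) <= (1 - x) * (1 - x) ^+ k.
  by rewrite ler_wpM2l// subr_ge0.
have : 0 <= k%:R * x * x by rewrite !mulr_ge0.
by rewrite exprS -natr1; lra.
Qed.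

(** The first two terms of the binomial expansion, in the form needed to add one
    draw to [expect_subset_le]. *)
Lemma expD_ge (x y : R) k : 0 <= x -> 0 <= y ->
  x ^+ k + k%:R * y * x ^+ k.-1 <= (x + y) ^+ k.
Proof.
move=> x0 y0; elim: k => [|[|k] IH]; first by rewrite !mul0r addr0.
  by rewrite !expr1 expr0 mulr1 mul1r.
rewrite [leRHS]exprS; apply: le_trans (ler_wpM2l (addr_ge0 x0 y0) IH).
have : 0 <= k.+1%:R * y ^+ 2 * x ^+ k by rewrite !mulr_ge0 ?exprn_ge0.
rewrite /= !exprS -[k.+2%:R]natr1; set a := k.+1%:R; set b := x ^+ k.
by rewrite expr0 mulr1; lra.
Qed.

Lemma prod_if_lt (a b : R) r k : (k <= r)%N ->
  \prod_(l < r) (if (l < k)%N then a else b) = a ^+ k * b ^+ (r - k).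
Proof.
move=> kr; rewrite -(big_mkord xpredT (fun l => if (l < k)%N then a else b)).
rewrite (big_cat_nat (leq0n k) kr)/=; congr (_ * _).
  rewrite (eq_big_nat _ _ (F2 := fun=> a)); last by move=> l /andP[_ ->].
  by rewrite prodr_const_nat subn0.
rewrite (eq_big_nat _ _ (F2 := fun=> b)) ?prodr_const_nat// => l /andP[kl _].
by rewrite ltnNge kl.
Qed.

End PowerInequalities.

Section Appearance.
Context {R : realType} {S : finType}.
Implicit Types (F : {set S}) (w : seq S).

Lemma subset_cons F (e : S) w : (F \subset e :: w) = (F :\ e \subset w).
Proof.
apply/fintype.subsetP/fintype.subsetP => h z.
  by rewrite !inE => /andP[/negPf ze /h]; rewrite inE ze.
by move=> zF; rewrite inE; have [//|ze] := eqVneq z e; apply: h; rewrite !inE ze.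
Qed.

(** Conditioning on the last draw: it removes one element from the set of those
    that are still to appear, or leaves this set unchanged. *)
Lemma expect_subsetS F t :
  expect t.+1 (fun w => (F \subset w)%:R)
  = average (fun e => expect t (fun w => (F :\ e \subset w)%:R)) :> R.
Proof.
rewrite /= -expect_average; apply: eq_expect => w _; apply: eq_average => e.
by rewrite subset_cons.
Qed.

Lemma average_setD1 F (a b : R) (f : S -> R) :
  (forall e, f e = if e \in F then a else b) -> (0 < #|S|)%N ->
  average f = #|F|%:R / #|S|%:R * a + (1 - #|F|%:R / #|S|%:R) * b.
Proof.
move=> fE S0; have SN : #|S|%:R != 0 :> R by rewrite pnatr_eq0 -lt0n.
rewrite /average (eq_bigr _ (fun e _ => fE e)) (bigID (mem F))/=.
rewrite (eq_bigr (fun=> a)); last by move=> e ->.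
rewrite [X in _ + X](eq_bigr (fun=> b)); last by move=> e /negPf ->.
rewrite !sumr_const.
have -> : #|[pred e | e \notin F]| = (#|S| - #|F|)%N by rewrite -(cardC (mem F)) addKn.
rewrite -(mulr_natl a) -(mulr_natl b) natrB; last exact: max_card.
move: (#|F|%:R : R) (#|S|%:R : R) SN => k s s0.
by field.
Qed.

Lemma card_setD1_mem F e : #|F :\ e| = (if e \in F then #|F|.-1 else #|F|).
Proof. by rewrite (cardsD1 e F); case: (e \in F). Qed.

(** Draws of distinct elements are negatively correlated, so the probability that
    [F] appears is at most that of independent events of probability
    [t / #|S|]. *)
Lemma expect_subset_le F t : (0 < #|S|)%N ->
  expect t (fun w => (F \subset w)%:R) <= (t%:R / #|S|%:R) ^+ #|F| :> R.
Proof.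
move=> S0; have Sp : (0 : R) < #|S|%:R by rewrite ltr0n.
elim: t F => [|t IH] F.
  rewrite /= mul0r expr0n cards_eq0; have [->|F0] := eqVneq F finset.set0.
    by case: (_ \subset _).
  rewrite (_ : (F \subset [::]) = false)//; apply/negbTE; apply: contra F0.
  by move=> /fintype.subsetP h; apply/eqP/setP => z; rewrite inE; apply/negP => /h.
rewrite expect_subsetS.
pose g k : R := (t%:R / #|S|%:R) ^+ k.
apply: (@le_trans _ _ (average (fun e => if e \in F then g #|F|.-1 else g #|F|))).
  by apply: average_le => e; apply: le_trans (IH _) _; rewrite card_setD1_mem; case: ifP.
rewrite (average_setD1 (fun=> erefl)) // /g.
have FS : #|F|%:R / #|S|%:R <= 1 :> R by rewrite ler_pdivrMr// mul1r ler_nat max_card.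
have := @expD_ge R (t%:R / #|S|%:R) (#|S|%:R^-1) #|F|.
rewrite divr_ge0// invr_ge0 (ltW Sp) => /(_ isT isT).
have -> : t.+1%:R / #|S|%:R = t%:R / #|S|%:R + #|S|%:R^-1 :> R.
  by rewrite -natr1 mulrDl mul1r.
move=> h; apply: (le_trans _ h).
have : 0 <= #|F|%:R / #|S|%:R * (t%:R / #|S|%:R) ^+ #|F| :> R.
  by rewrite mulr_ge0 ?exprn_ge0 ?divr_ge0.
set X := _ ^+ #|F|; set Y := _ ^+ _; set Z := _ / _; lra.
Qed.

Lemma ffact_pascal m k : (m.+1 ^_ k = m ^_ k + k * m ^_ k.-1)%N.
Proof.
case: k => [|k]; first by rewrite !ffactn0 mul0n.
rewrite /= -!bin_ffact binS mulnDl factS; lia.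
Qed.

(** The left-hand side is at most the probability that each element of [F] is
    drawn exactly once; Pascal's rule makes the induction on [t] close. *)
Lemma expect_subset_ge F t : (#|F| <= #|S|)%N -> (0 < #|S|)%N ->
  (t ^_ #|F|)%:R / #|S|%:R ^+ #|F| * (1 - #|F|%:R / #|S|%:R) ^+ t
  <= expect t (fun w => (F \subset w)%:R) :> R.
Proof.
move=> FS S0; have Sp : (0 : R) < #|S|%:R by rewrite ltr0n.
elim: t F FS => [|t IH] F FS.
  rewrite /= expr0 mulr1; have [->|F0] := eqVneq F finset.set0.
    rewrite cards0 ffactn0 expr0 divr1 (_ : _ \subset _)//.
    by apply/fintype.subsetP => z; rewrite inE.
  by rewrite -cards_eq0 -lt0n in F0; rewrite ffact_small// mul0r.
rewrite expect_subsetS; set k := #|F|.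
pose g j : R := (t ^_ j)%:R / #|S|%:R ^+ j * (1 - j%:R / #|S|%:R) ^+ t.
apply: (@le_trans _ _ (average (fun e => if e \in F then g k.-1 else g k))); last first.
  apply: average_le => e; apply: le_trans (IH _ _); last first.
    by rewrite max_card.
  by rewrite card_setD1_mem /g /k; case: ifP.
rewrite (average_setD1 (fun=> erefl)) // -/k /g.
have kS : k%:R / #|S|%:R <= 1 :> R by rewrite ler_pdivrMr// mul1r ler_nat max_card.
have k0 : 0 <= k%:R / #|S|%:R :> R by rewrite divr_ge0.
have [k00|kp] := posnP k.
  by rewrite k00 !ffactn0 !mul0r !subr0 !expr1n !expr0 !divr1 !mulr1 add0r.
have Ek : #|S|%:R ^+ k = #|S|%:R * #|S|%:R ^+ k.-1 :> R by rewrite -exprS prednK.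
have mono : (1 - k%:R / #|S|%:R) ^+ t.+1 <= (1 - k.-1%:R / #|S|%:R) ^+ t :> R.
  apply: (@le_trans _ _ ((1 - k%:R / #|S|%:R) ^+ t)).
    by rewrite exprS ler_piMl ?exprn_ge0 ?subr_ge0// gerBl.
  have le1 : 1 - k%:R / #|S|%:R <= 1 - k.-1%:R / #|S|%:R :> R.
    by rewrite lerD2l lerN2 ler_pM2r ?invr_gt0// ler_nat leq_pred.
  have ge0 : 0 <= 1 - k%:R / #|S|%:R :> R by rewrite subr_ge0.
  by apply: lerXn2r; rewrite ?nnegrE// (le_trans ge0).
have -> : (t.+1 ^_ k)%:R = (t ^_ k)%:R + k%:R * (t ^_ k.-1)%:R :> R.
  by rewrite ffact_pascal natrD natrM.
have -> : k%:R / #|S|%:R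
      * ((t ^_ k.-1)%:R / #|S|%:R ^+ k.-1 * (1 - k.-1%:R / #|S|%:R) ^+ t)
    = k%:R * (t ^_ k.-1)%:R / #|S|%:R ^+ k * (1 - k.-1%:R / #|S|%:R) ^+ t :> R.
  rewrite Ek invfM; move: (k%:R : R) (#|S|%:R^-1 : R) => k' S'.
  set x := _ ^-1; set y := _ ^+ t; set z := (t ^_ _)%:R; ring.
rewrite mulrDl mulrDl addrC lerD//.
  by rewrite ler_wpM2l// divr_ge0 ?exprn_ge0// mulr_ge0.
by rewrite mulrCA -exprS.
Qed.

End Appearance.

(** * Increasing paths and their overlaps *)

Section Paths.
Context {n r : nat}.
Implicit Types (x y z : cube n) (i : 'I_n) (d : {ffun 'I_r -> 'I_n}).
Implicit Types (w : seq (edge n)).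

(** An increasing path from [x] follows a sequence of distinct directions [d], so
    its vertex at level [k] is determined by the set of the first [k] directions. *)
Definition visited d (k : nat) : {set 'I_n} := [set d l | l : 'I_r & (l < k)%N]%SET.

Definition vertex x d k : cube n := [ffun j => x j (+) (j \in visited d k)].

Definition path_edge x d (k : 'I_r) : edge n := edge_of (vertex x d k) (d k).

Definition path_edges x d : {set edge n} := [set path_edge x d k | k : 'I_r]%SET.

(** Sequences that never use direction [i] keep a path inside one half of the cube;
    the paths from the two ends of an edge in direction [i] then use disjoint sets
    of edges. *)
Definition avoiding i : {set {ffun 'I_r -> 'I_n}} :=
  [set d : {ffun 'I_r -> 'I_n} | injectiveb d & [forall k, d k != i]]%SET.

Lemma avoidingP i d : d \in avoiding i -> injective d /\ (forall k, d k != i).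
Proof. by rewrite inE => /andP[/injectiveP ? /forallP]. Qed.

Lemma card_avoiding i : #|avoiding i| = (n.-1 ^_ r)%N.
Proof.
have -> : n.-1 = #|[set~ i]%SET| by rewrite cardsC1 card_ord.
have := card_inj_ffuns_on 'I_r (mem [set~ i]%SET); rewrite card_ord => <-.
apply: eq_card => d; rewrite !inE andbC; congr (_ && _).
apply/forallP/ffun_onP => h k; have := h k; by rewrite !inE.
Qed.

Lemma mem_visited d k (l : 'I_r) : injective d ->
  (d l \in visited d k) = (l < k)%N.
Proof.
move=> dI; apply/imsetP/idP => [[l' + /dI ->]|lk]; first by rewrite inE.
by exists l => //; rewrite inE.
Qed.

Lemma card_visited d k : injective d -> (k <= r)%N -> #|visited d k| = k.
Proof.
move=> dI kr; rewrite card_imset// -[RHS]card_ord.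
have wI : injective (widen_ord kr) by move=> a b /(congr1 val) /= /val_inj.
rewrite -[RHS](card_imset _ wI); apply: eq_card => l; rewrite inE.
apply/idP/imsetP => [lk|[m _ ->]]; last exact: (ltn_ord m).
by exists (Ordinal lk) => //; apply: val_inj.
Qed.

Lemma vertexS x d (k : 'I_r) : injective d ->
  vertex x d k.+1 = flip (d k) (vertex x d k).
Proof.
move=> dI; apply/ffunP => j; rewrite !ffunE -addbA; congr (_ (+) _).
have [->|jk] := eqVneq j (d k).
  by rewrite !mem_visited// ltnS leqnn ltnn.
rewrite addbF; apply/imsetP/imsetP => -[l + e].
  rewrite inE ltnS leq_eqVlt => /orP[/eqP/val_inj lk|lk].
    by rewrite e lk eqxx in jk.
  by exists l => //; rewrite inE.
by rewrite inE => lk; exists l => //; rewrite inE ltnS ltnW.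
Qed.

Lemma vertex0 x d : vertex x d 0 = x.
Proof.
apply/ffunP => j; rewrite ffunE (_ : _ \in _ = false) ?addbF//.
by apply/negbTE/negP => /imsetP[l]; rewrite inE ltn0.
Qed.

Lemma visited_inj x d d' k k' : vertex x d k = vertex x d' k' ->
  visited d k = visited d' k'.
Proof.
move=> /ffunP e; apply/setP => j; have := e j; rewrite !ffunE.
exact: addbI.
Qed.

(** An edge shared by two increasing paths from [x] fixes the level at which it is
    used, its direction, and the set of the directions used before. *)
Lemma path_edge_inj x d d' (k k' : 'I_r) : injective d -> injective d' ->
  path_edge x d k = path_edge x d' k' ->
  [/\ k = k', d k = d' k' & visited d k = visited d' k'].
Proof.
move=> dI dI' /edge_of_inj[dk].
(* coordinate [d k] has not been flipped yet on either path, which excludes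
   opposite orientations *)
have v0 : vertex x d' k' (d k) = vertex x d k (d k).
  by rewrite !ffunE (mem_visited _ _ dI) ltnn dk (mem_visited _ _ dI') ltnn.
move=> [/esym/visited_inj e|e]; last first.
  by move: v0; rewrite e ffunE eqxx; case: (vertex _ _ _ _).
split=> //; apply: val_inj => /=.
by rewrite -(card_visited dI (ltnW (ltn_ord k))) e card_visited// ltnW.
Qed.

Lemma card_path_edges x d : injective d -> #|path_edges x d| = r.
Proof.
by move=> dI; rewrite card_imset ?card_ord// => k k' /(path_edge_inj dI dI)[].
Qed.

Lemma path_edges_disjoint x y d d' i : x i != y i ->
  (forall k, d k != i) -> (forall k, d' k != i) ->
  [disjoint path_edges x d & path_edges y d'].
Proof.
move=> xy di di'; apply/pred0P => e /=; apply/negP => /andP[/imsetP[k _ ->]].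
have vi (z : cube n) (f : {ffun 'I_r -> 'I_n}) m :
    (forall l, f l != i) -> vertex z f m i = z i.
  move=> fi; rewrite ffunE (_ : _ \in _ = false) ?addbF//.
  by apply/negbTE/negP => /imsetP[l _ e']; have := fi l; rewrite -e' eqxx.
have fl v : flip (d k) v i = v i by rewrite ffunE eq_sym (negbTE (di k)) addbF.
move=> /imsetP[k' _ /edge_of_inj[_]] [] /(congr1 (fun v : cube n => v i));
  by rewrite ?fl !vi// => yx; rewrite yx eqxx in xy.
Qed.

Lemma joined_mem w (e : edge n) : e \in (w : seq (edge n)) -> joined (cluster_of w) e.
Proof.
elim: w => // e' w IH; rewrite inE => /orP[/eqP ->|/IH].
  exact: edge_sub_cluster_cons.
exact: joined_cluster_cons.
Qed.

(** The first [r] vertices of an open path are distinct points of the cluster. *)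
Lemma cluster_of_path w x d : injective d -> path_edges x d \subset w ->
  (r <= #|cluster_of w x|)%N.
Proof.
move=> dI /fintype.subsetP sub; have pc := cluster_partitioning w.
have mem k : (k <= r)%N -> vertex x d k \in cluster_of w x.
  elim: k => [|k IH] kr; first by rewrite vertex0 pc.1.
  have -> : vertex x d k.+1 = flip (d (Ordinal kr)) (vertex x d k).
    exact: (vertexS x (Ordinal kr) dI).
  rewrite -(pc.2 _ _ (IH (ltnW kr))) -joined_of//.
  by apply: joined_mem; apply: sub; apply/imsetP; exists (Ordinal kr).
rewrite -[X in (X <= _)%N](card_ord r).
rewrite -(card_imset _ (f := fun k : 'I_r => vertex x d k)).
  apply: subset_leq_card; apply/fintype.subsetP => z /imsetP[k _ ->].
  by apply: mem; apply: ltnW.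
move=> k k' /visited_inj e; apply: val_inj => /=.
by rewrite -(card_visited dI (ltnW (ltn_ord k))) e card_visited// ltnW.
Qed.

Section Overlap.
Context {R : realType}.
Variable rho : R.
Hypothesis rho01 : 0 <= rho <= 1.

(** Let [k] be the last level of a shared edge, plus one. Either the two paths
    agree on all the first [k] steps, and share at most [k] edges, or they share
    at most [k - 1] edges while the first [k] directions of [d'] all belong to
    [d]. The second case is negligible in large dimension: it restricts [k]
    directions and gains only [k - 1] factors [rho]. *)
Lemma overlap_bound x d d' : injective d -> injective d' ->
  rho ^+ #|path_edges x d :|: path_edges x d'|
  <= \sum_(k < r.+1) rho ^+ (r + r - k)
       * [forall l : 'I_r, (l < k)%N ==> (d' l == d l)]%:R
   + \sum_(k < r) rho ^+ (r + r - k)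
       * [forall l : 'I_r, (l < k.+1)%N ==> (d' l \in visited d r)]%:R.
Proof.
move=> dI dI'.
have rho0 : 0 <= rho by case/andP: rho01.
have anti a b : (a <= b)%N -> rho ^+ b <= rho ^+ a.
  by move=> ab; case/andP: rho01 => r0 r1; apply: ler_wiXn2l.
pose I := [set k : 'I_r | path_edge x d k == path_edge x d' k]%SET.
have cI : (r + r - #|I| <= #|path_edges x d :|: path_edges x d'|)%N.
  rewrite cardsU !card_path_edges// leq_sub2l//.
  rewrite -(card_imset _ (f := path_edge x d)); last first.
    by move=> k k' /(path_edge_inj dI dI)[].
  apply: subset_leq_card; apply/fintype.subsetP => e.
  rewrite inE => /andP[/imsetP[k _ ->] /imsetP[k' _ kk']].
  apply/imsetP; exists k => //; rewrite inE.
  by have [e1 _ _] := path_edge_inj dI dI' kk'; rewrite {2}e1 -kk'.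
apply: (le_trans (anti _ _ cI)).
have pos1 (k : 'I_r.+1) : true -> 0 <= rho ^+ (r + r - k)
    * [forall l : 'I_r, (l < k)%N ==> (d' l == d l)]%:R.
  by move=> _; rewrite mulr_ge0// exprn_ge0.
have pos2 (k : 'I_r) : true -> 0 <= rho ^+ (r + r - k)
    * [forall l : 'I_r, (l < k.+1)%N ==> (d' l \in visited d r)]%:R.
  by move=> _; rewrite mulr_ge0// exprn_ge0.
have [I0|/finset.set0Pn[k0 k0I]] := eqVneq I finset.set0.
  rewrite I0 cards0 subn0 (bigD1 ord0)//= subn0 (_ : [forall l : 'I_r, _]); last first.
    by apply/forallP.
  by rewrite mulr1 -addrA lerDl; apply: addr_ge0;
    apply: sumr_ge0 => k _; [exact: pos1|exact: pos2].
(* [k] is the position of the last shared edge, so that the two paths have to be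
   compared on their first [k.+1] steps *)
have [k kI kmax] := arg_maxnP (fun k : 'I_r => val k) k0I.
have kI' : path_edge x d k == path_edge x d' k.
  by have : k \in I by []; rewrite inE.
have [_ dk vk] := path_edge_inj dI dI' (eqP kI').
have Ile (l : 'I_r) : l \in I -> (l <= k)%N by move=> lI; exact: kmax.
have cardle m : (m <= r)%N -> #|[set l : 'I_r | (l < m)%N]%SET| = m.
  by move=> mr; rewrite -[RHS](card_visited dI mr) card_imset.
have [/forallP ag|] := boolP [forall l : 'I_r, (l < k.+1)%N ==> (d' l == d l)].
  apply: (@le_trans _ _ (rho ^+ (r + r - k.+1))).
    apply: anti; apply: leq_sub2l; rewrite -[X in (_ <= X)%N](cardle k.+1)//.
    by apply: subset_leq_card; apply/fintype.subsetP => l lI; rewrite inE ltnS Ile.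
  have kr : (k.+1 < r.+1)%N by rewrite ltnS.
  rewrite (bigD1 (Ordinal kr))//= (_ : [forall l : 'I_r, _]); last exact/forallP.
  by rewrite mulr1 -addrA lerDl; apply: addr_ge0;
    apply: sumr_ge0 => m _; [exact: pos1|exact: pos2].
rewrite negb_forall => /existsP[l0]; rewrite negb_imply => /andP[l0k l0d].
apply: (@le_trans _ _ (rho ^+ (r + r - k))).
  apply: anti; apply: leq_sub2l; rewrite -ltnS -[X in (_ < X)%N](cardle k.+1)//.
  apply: proper_card; apply/fintype.properP; split.
    by apply/fintype.subsetP => l lI; rewrite inE ltnS Ile.
  exists l0; first by rewrite inE.
  rewrite inE; apply: contra l0d => /eqP/(path_edge_inj dI dI')[_ -> _].
  exact: eqxx.
rewrite [X in _ + X](bigD1 k)//= (_ : [forall l : 'I_r, _]); last first.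
  apply/forallP => l; apply/implyP; rewrite ltnS leq_eqVlt => /orP[/eqP/val_inj ->|lk].
    by rewrite -dk mem_visited.
  have : d' l \in visited d k by rewrite vk mem_visited.
  by move=> /imsetP[m _ ->]; rewrite mem_visited.
by rewrite mulr1 addrCA lerDl; apply: addr_ge0;
    apply: sumr_ge0 => m _; [exact: pos1|exact: pos2].
Qed.

(** The directions can be chosen independently once injectivity is dropped. *)
Lemma sum_forall (a : R) (f : 'I_r -> 'I_n -> bool) (k : nat) :
  (k <= r)%N -> 0 <= a ->
  (forall l : 'I_r, (l < k)%N -> \sum_j (f l j)%:R <= a) ->
  \sum_(d : {ffun 'I_r -> 'I_n}) [forall l : 'I_r, (l < k)%N ==> f l (d l)]%:R
  <= a ^+ k * n%:R ^+ (r - k).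
Proof.
move=> kr a0 fa; rewrite -prod_if_lt//.
have -> : \sum_(d : {ffun 'I_r -> 'I_n}) [forall l : 'I_r, (l < k)%N ==> f l (d l)]%:R
    = \sum_(d : {ffun 'I_r -> 'I_n}) \prod_(l < r) ((l < k)%N ==> f l (d l))%:R :> R.
  apply: eq_bigr => d _; case: (boolP [forall l, _]) => [/forallP h|].
    by rewrite big1// => l _; rewrite h.
  rewrite negb_forall => /existsP[l /negPf hl].
  by rewrite (bigD1 l)//= hl mul0r.
rewrite -(bigA_distr_bigA (fun (l : 'I_r) (j : 'I_n) => ((l < k)%N ==> f l j)%:R)).
apply: ler_prod => l _; rewrite sumr_ge0//=.
case: (ltnP l k) => lk /=; first exact: fa.
by rewrite sumr_const card_ord.
Qed.

Lemma overlap_sum x d : injective d ->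
  \sum_(d' : {ffun 'I_r -> 'I_n} | injectiveb d')
    rho ^+ #|path_edges x d :|: path_edges x d'|
  <= \sum_(k < r.+1) rho ^+ (r + r - k) * n%:R ^+ (r - k)
   + \sum_(k < r) rho ^+ (r + r - k) * (r%:R ^+ k.+1 * n%:R ^+ (r - k.+1)).
Proof.
move=> dI; have rho0 : 0 <= rho by case/andP: rho01.
apply: (@le_trans _ _ (\sum_(d' : {ffun 'I_r -> 'I_n})
  (\sum_(k < r.+1) rho ^+ (r + r - k)
       * [forall l : 'I_r, (l < k)%N ==> (d' l == d l)]%:R
   + \sum_(k < r) rho ^+ (r + r - k)
       * [forall l : 'I_r, (l < k.+1)%N ==> (d' l \in visited d r)]%:R))).
  rewrite big_mkcond; apply: ler_sum => d' _; case: ifP => [/injectiveP dI'|_].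
    exact: overlap_bound.
  by rewrite addr_ge0// sumr_ge0// => k _; rewrite mulr_ge0// exprn_ge0.
rewrite big_split/= lerD//.
  rewrite exchange_big/=; apply: ler_sum => k _.
  rewrite -mulr_sumr ler_wpM2l ?exprn_ge0//.
  have kr : (k <= r)%N by rewrite -ltnS.
  have := @sum_forall 1 (fun l j => j == d l) k kr ler01.
  rewrite expr1n mul1r; apply=> l _.
  by rewrite (bigD1 (d l))//= eqxx big1 ?addr0// => j /negPf ->.
rewrite exchange_big/=; apply: ler_sum => k _.
rewrite -mulr_sumr ler_wpM2l ?exprn_ge0//.
apply: (sum_forall (f := fun l j => j \in visited d r)) => // l _.
by rewrite -natr_sum -big_mkcond/= sum1_card card_visited.
Qed.

End Overlap.
End Paths.

(** * First and second moments of the number of open paths *)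

Section OverlapNumerics.
Context {R : realType}.

(** With [lam = n * rho], the first sum is geometric of ratio [1 / lam] and gives at
    most [lam0 / (lam0 - 1)]. The second one has a power of [n] less, and gives at
    most [r ^ r.+1 / n <= 1]. *)
Lemma overlap_numeric n r (rho lam0 : R) :
  0 <= rho -> 1 < lam0 -> lam0 <= n%:R * rho -> (0 < r)%N -> (r ^ r.+1 <= n)%N ->
  n%:R ^+ r * (\sum_(k < r.+1) rho ^+ (r + r - k) * n%:R ^+ (r - k)
   + \sum_(k < r) rho ^+ (r + r - k) * (r%:R ^+ k.+1 * n%:R ^+ (r - k.+1)))
  <= (n%:R * rho) ^+ (r + r) * (lam0 / (lam0 - 1) + 1).
Proof.
move=> rho0 lam1 lamn r0 rn; set lam := n%:R * rho in lamn *.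
have lam1' : 1 < lam by apply: lt_le_trans lamn.
have lam_ge0 : 0 <= lam by lra.
have n0 : (0 < n)%N by apply: leq_trans rn; rewrite expn_gt0 r0.
have n0R : (0 : R) < n%:R by rewrite ltr0n.
have mono a b : (a <= b)%N -> lam ^+ a <= lam ^+ b.
  by move=> ab; apply: ler_weXn2l => //; exact: ltW.
rewrite mulrDr mulrDr mulr1 lerD//.
  rewrite mulr_sumr.
  have -> : \sum_(k < r.+1) n%:R ^+ r * (rho ^+ (r + r - k) * n%:R ^+ (r - k))
      = lam ^+ r * \sum_(k < r.+1) lam ^+ k.
    rewrite mulr_sumr (reindex_inj rev_ord_inj)/=; apply: eq_bigr => k _.
    have kr : (k <= r)%N by rewrite -ltnS.
    rewrite subSS (subKn kr) -exprD /lam exprMn mulrCA -exprD mulrC.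
    by congr (_ * _ ^+ _); lia.
  rewrite exprD -mulrA ler_wpM2l ?exprn_ge0//.
  have E := subrX1 lam r.+1.
  have h : \sum_(k < r.+1) lam ^+ k <= lam ^+ r * (lam / (lam - 1)).
    rewrite mulrA ler_pdivlMr ?subr_gt0// mulrC -E -exprSr.
    by rewrite lerBlDr lerDl.
  apply: le_trans h _; rewrite ler_wpM2l ?exprn_ge0//.
  rewrite ler_pdivrMr ?subr_gt0// mulrAC ler_pdivlMr ?subr_gt0//.
  by nra.
(* the second sum, multiplied by [n] to absorb its missing power of the dimension *)
rewrite -(ler_pM2l n0R) mulr_sumr mulr_sumr.
apply: (@le_trans _ _ (\sum_(k < r) lam ^+ (r + r) * r%:R ^+ r)).
  apply: ler_sum => k _; have kr := ltn_ord k.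
  have -> : n%:R * (n%:R ^+ r * (rho ^+ (r + r - k) * (r%:R ^+ k.+1 * n%:R ^+ (r - k.+1))))
      = lam ^+ (r + r - k) * r%:R ^+ k.+1.
    rewrite /lam exprMn (_ : r + r - k = 1 + (r + (r - k.+1)))%N; last lia.
    by rewrite !exprD; ring.
  apply: ler_pM; rewrite ?exprn_ge0//; first by apply: mono; rewrite leq_subr.
  by apply: ler_weXn2l => //; rewrite ler1n.
rewrite sumr_const card_ord -[leLHS]mulr_natr -mulrA -exprSr mulrC.
by rewrite ler_wpM2r ?exprn_ge0// -natrX ler_nat.
Qed.

End OverlapNumerics.

Section SecondMoment.
Context {R : realType} {n r m : nat}.
Implicit Types (x y z : cube n) (i : 'I_n) (w : seq (edge n)).

Lemma subset_setU_seq (S : finType) (F G : {set S}) (w : seq S) :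
  (F :|: G \subset w) = (F \subset w) && (G \subset w).
Proof.
apply/fintype.subsetP/andP => [h|[/fintype.subsetP h1 /fintype.subsetP h2] z].
  by split; apply/fintype.subsetP => z zF; apply: h; rewrite inE zF ?orbT.
by rewrite inE => /orP[/h1|/h2].
Qed.

Definition open_paths i x w : R :=
  \sum_(d in @avoiding n r i) (path_edges x d \subset w)%:R.

Let rho : R := m%:R / #|{: edge n}|%:R.

Lemma open_paths_mul i x y w :
  open_paths i x w * open_paths i y w
  = \sum_(d in @avoiding n r i) \sum_(d' in @avoiding n r i)
      (path_edges x d :|: path_edges y d' \subset w)%:R.
Proof.
rewrite /open_paths mulr_suml; apply: eq_bigr => d _; rewrite mulr_sumr.
by apply: eq_bigr => d' _; rewrite subset_setU_seq -mulnb natrM.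
Qed.

Lemma expect_open_paths (c : R) i x : (0 < n)%N -> 
  (forall F : {set edge n}, #|F| = (r + r)%N ->
     c <= expect m (fun w => (F \subset w)%:R)) ->
  c * (#|@avoiding n r i| ^ 2)%:R
  <= expect m (fun w => open_paths i x w * open_paths i (flip i x) w).
Proof.
move=> n0 hc.
rewrite (eq_expect (fun w _ => open_paths_mul i x (flip i x) w)) expect_sum.
under eq_bigr do rewrite expect_sum.
have -> : c * (#|@avoiding n r i| ^ 2)%:R
   = \sum_(d in @avoiding n r i) \sum_(d' in @avoiding n r i) c.
  by rewrite !sumr_const -mulrnA -[RHS]mulr_natr.
apply: ler_sum => d /avoidingP[dI di]; apply: ler_sum => d' /avoidingP[dI' di'].
apply: hc; rewrite cardsU finset.disjoint_setI0 ?cards0 ?subn0 ?card_path_edges//.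
apply: path_edges_disjoint di di'.
by rewrite ffunE eqxx; case: (x i).
Qed.

(** The paths from the two ends are edge-disjoint, so the exponents add up and the
    fourfold sum is a product of two overlap sums. *)
Lemma expect_open_paths_sqr (B : R) i x : (0 < n)%N -> (m <= #|{: edge n}|)%N ->
  (forall z, \sum_(d in @avoiding n r i) \sum_(d' in @avoiding n r i)
     rho ^+ #|path_edges z d :|: path_edges z d'| <= B) ->
  expect m (fun w => (open_paths i x w * open_paths i (flip i x) w) ^+ 2) <= B ^+ 2.
Proof.
move=> n0 mM hB; have M0 := card_edges_gt0 n0.
have rho0 : 0 <= rho by rewrite divr_ge0.
set y := flip i x.
have E w : (open_paths i x w * open_paths i y w) ^+ 2
  = \sum_(d1 in @avoiding n r i) \sum_(d2 in @avoiding n r i)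
    \sum_(d1' in @avoiding n r i) \sum_(d2' in @avoiding n r i)
      ((path_edges x d1 :|: path_edges x d2)
        :|: (path_edges y d1' :|: path_edges y d2') \subset w)%:R.
  rewrite exprMn !expr2 !open_paths_mul mulr_suml; apply: eq_bigr => d1 _.
  rewrite mulr_suml; apply: eq_bigr => d2 _.
  rewrite mulr_sumr; apply: eq_bigr => d1' _.
  rewrite mulr_sumr; apply: eq_bigr => d2' _.
  by rewrite [in RHS]subset_setU_seq -mulnb natrM.
rewrite (eq_expect (fun w _ => E w)) expect_sum.
have -> : B ^+ 2 = B * B by rewrite expr2.
have S0 z : 0 <= \sum_(d in @avoiding n r i) \sum_(d' in @avoiding n r i)
     rho ^+ #|path_edges z d :|: path_edges z d'|.
  by apply: sumr_ge0 => d _; apply: sumr_ge0 => d' _; rewrite exprn_ge0.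
apply: le_trans (ler_pM (S0 x) (S0 y) (hB x) (hB y)).
rewrite mulr_suml; apply: ler_sum => d1 /avoidingP[_ h1].
rewrite expect_sum mulr_suml; apply: ler_sum => d2 /avoidingP[_ h2].
rewrite expect_sum mulr_sumr; apply: ler_sum => d1' /avoidingP[_ h1'].
rewrite expect_sum mulr_sumr; apply: ler_sum => d2' /avoidingP[_ h2'].
apply: le_trans (expect_subset_le _ _ M0) _; rewrite -/rho -exprD.
rewrite (cardsU (path_edges x d1 :|: path_edges x d2)).
rewrite finset.disjoint_setI0 ?cards0 ?subn0//.
have xy : x i != y i by rewrite ffunE eqxx; case: (x i).
by rewrite -finset.setI_eq0 finset.setIUl !finset.setIUr !finset.setU_eq0
  !finset.setI_eq0 !(path_edges_disjoint xy).
Qed.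

End SecondMoment.

(** * Both ends of an edge lie in large clusters *)

Section BigPairs.
Context {R : realType}.

Lemma expn_sub_ffact a k : ((a - k) ^ k <= a ^_ k)%N.
Proof.
rewrite ffact_prod -[X in (_ ^ X <= _)%N]card_ord -prod_nat_const.
by apply: leq_prod => i _; rewrite leq_sub2l// ltnW.
Qed.

Lemma exp_sub_half (a s k : nat) : (0 < a)%N -> (2 * k * s <= a)%N -> (s <= a)%N ->
  a%:R ^+ k / 2 <= ((a - s) ^ k)%:R :> R.
Proof.
move=> a0 ksa sa; have aR : (0 : R) < a%:R by rewrite ltr0n.
have -> : ((a - s) ^ k)%:R = a%:R ^+ k * (1 - s%:R / a%:R) ^+ k :> R.
  rewrite -exprMn natrX natrB// mulrBr mulr1 mulrC -mulrA mulVf ?mulr1//.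
  by rewrite gt_eqF.
rewrite ler_wpM2l ?exprn_ge0//.
have h : (0 : R) <= s%:R / a%:R <= (1 : R).
  by apply/andP; split; [rewrite divr_ge0 | rewrite ler_pdivrMr// mul1r ler_nat].
apply: le_trans (one_sub_expn_ge k h).
have : k%:R * (s%:R / a%:R) <= 2^-1 :> R.
  by rewrite mulrA ler_pdivrMr//; move: ksa; rewrite -(ler_nat R) !natrM; lra.
lra.
Qed.

(** The constant produced by [second_moment]. It does not depend on the length of
    the paths, which is what makes [join_prob_percolation] possible. *)
Definition pair_constant (lam0 : R) : R := (16 * (lam0 / (lam0 - 1) + 1)) ^- 2.

(** The inequalities, for a fixed path length [r] and a large dimension, that make
    all correction factors at least one half. *)
Lemma path_length_negligible (n r m M N : nat) : (0 < r)%N ->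
  (16 * r * r + 2 * r * r.+1 + 8 * r + 2 <= n)%N ->
  (n < N)%N -> (N * n = 2 * M)%N -> (N < 2 * m)%N -> (m <= N)%N ->
  [/\ (N <= M)%N, (2 * (r + r) * (r + r) <= m)%N, (r + r <= m)%N,
      (2 * r * r.+1 <= n)%N & (2 * (m * (r + r)) <= M)%N].
Proof.
move=> r0 hn nN NM Nm mN.
have : (N * 2 <= N * n)%N by rewrite leq_mul2l; apply/orP; right; lia.
have : (N * (8 * r) <= N * n)%N by rewrite leq_mul2l; apply/orP; right; lia.
have : (m * r <= N * r)%N by rewrite leq_mul2r mN orbT.
have : (r <= r * r)%N by rewrite leq_pmulr.
move: hn; set rr := (r * r)%N.
have -> : (16 * r * r + 2 * r * r.+1 + 8 * r + 2 = 18 * rr + 10 * r + 2)%N.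
  by rewrite /rr; lia.
have -> : (2 * (r + r) * (r + r) = 8 * rr)%N by rewrite /rr; lia.
have -> : (2 * r * r.+1 = 2 * rr + 2 * r)%N by rewrite /rr; lia.
by move=> *; split; lia.
Qed.

(** Second moment method for the number of pairs of open increasing paths, one
    from each end of the edge. Since [lam0 > 1] this number has a mean that grows
    with [r] but a normalised second moment that stays bounded, as for a
    supercritical branching process. *)
Lemma prob_both_big (lam0 : R) r : 1 < lam0 -> (0 < r)%N ->
  exists n1, forall n m (x : cube n) i, (n1 <= n)%N ->
    lam0 * (2 ^ n)%:R <= 2 * m%:R -> (m <= 2 ^ n)%N ->
    pair_constant lam0 <= expect m (fun w =>
      ((r <= #|cluster_of w x|)%N && (r <= #|cluster_of w (flip i x)|)%N)%:R).
Proof.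
move=> lam1 r0.
exists (r ^ r.+1 + (16 * r * r + 2 * r * r.+1 + 8 * r + 2))%N.
move=> n m x i n1n lamm mN.
have hn1 : (r ^ r.+1 <= n)%N by apply: leq_trans n1n; rewrite leq_addr.
have hn2 : (16 * r * r + 2 * r * r.+1 + 8 * r + 2 <= n)%N.
  by apply: leq_trans n1n; rewrite leq_addl.
clear n1n.
have n0 : (0 < n)%N by apply: leq_trans hn2; rewrite addnS.
have M0 := card_edges_gt0 n0.
have E := card_edges (n := n).
set M := #|{: edge n}| in M0 E.
have nN := ltn_expl n (ltnSn 1).
have N0R : (0 : R) < (2 ^ n)%:R by rewrite ltr0n expn_gt0.
have M0R : (0 : R) < M%:R by rewrite ltr0n.
have ER : (2 ^ n)%:R * n%:R = 2 * M%:R :> R by rewrite -!natrM E.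
have mlarge : (2 ^ n < 2 * m)%N.
  rewrite -(ltr_nat R) natrM; apply: lt_le_trans lamm.
  by rewrite -[ltLHS]mul1r ltr_pM2r.
have [MN hm1 hm2 hn3 hM] := path_length_negligible r0 hn2 nN E mlarge mN.
have mM : (m <= M)%N by apply: leq_trans mN MN.
have rM : (r + r <= M)%N by apply: leq_trans mM.
have m0 : (0 < m)%N by case: (m) mlarge; rewrite ?muln0.
pose rho : R := m%:R / M%:R.
have rho0 : 0 <= rho by rewrite divr_ge0.
have rho1 : rho <= 1 by rewrite ler_pdivrMr// mul1r ler_nat.
pose lam := n%:R * rho.
have lamE : lam = 2 * m%:R / (2 ^ n)%:R.
  rewrite /lam /rho; apply/eqP; rewrite mulrA.
  rewrite (eqr_div _ _ (lt0r_neq0 M0R) (lt0r_neq0 N0R)); apply/eqP.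
  move: ER; move: (n%:R : R) (m%:R : R) (M%:R : R) ((2 ^ n)%:R : R).
  move=> a b c d E'.
  by rewrite (_ : a * b * d = b * (d * a)); [rewrite E'; ring|ring].
have lam0lam : lam0 <= lam by rewrite lamE ler_pdivlMr.
have lam2 : lam <= 2 by rewrite lamE ler_pdivrMr// ler_pM2l// ler_nat.
pose C := lam0 / (lam0 - 1) + 1.
have lam_gt0 := lt_le_trans (lt_trans ltr01 lam1) lam0lam.
have C0 : 0 < C.
  by rewrite addr_gt0// divr_gt0 ?subr_gt0// (lt_trans ltr01 lam1).
have lamp : 0 < lam ^+ (r + r) by rewrite exprn_gt0.
have -> : pair_constant lam0 = (lam ^+ (r + r) / 16) ^+ 2 / (lam ^+ (r + r) * C) ^+ 2.
  rewrite /pair_constant -/C; field; rewrite !gt_eqF//.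
pose A z := @open_paths R n r i z.
apply: (second_moment (X := fun w => A x w * A (flip i x) w)).
- move=> w; apply/andP; split; first exact: ler0n.
  by rewrite (ler_nat R _ 1) leq_b1.
- move=> w; case: (boolP (_ && _)); first by rewrite mulr1.
  have A0 z : (#|cluster_of w z| < r)%N -> A z w = 0.
    move=> zr; apply: big1 => d /avoidingP[dI _].
    case: (boolP (_ \subset _)) => // /(cluster_of_path dI).
    by rewrite leqNgt zr.
  by rewrite negb_and -!ltnNge => /orP[] /A0 ->; rewrite !(mul0r, mulr0).
- by rewrite divr_gt0.
- have hc (F : {set edge n}) : #|F| = (r + r)%N ->
      rho ^+ (r + r) / 4 <= expect m (fun w => (F \subset w)%:R).
    move=> cF; apply: le_trans (expect_subset_ge _ _ M0); last first.
      by rewrite cF.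
    rewrite cF -/M.
    have h1 : m%:R ^+ (r + r) / 2 <= (m ^_ (r + r))%:R :> R.
      apply: (@le_trans _ _ ((m - (r + r)) ^ (r + r))%:R).
        by apply: exp_sub_half.
      by rewrite ler_nat expn_sub_ffact.
    have h2 : 2^-1 <= (1 - (r + r)%:R / M%:R) ^+ m :> R.
      have h : (0 : R) <= (r + r)%:R / M%:R <= (1 : R).
        apply/andP; split; first by rewrite divr_ge0.
        by rewrite ler_pdivrMr// mul1r ler_nat.
      apply: le_trans (one_sub_expn_ge m h).
      have : m%:R * ((r + r)%:R / M%:R) <= 2^-1 :> R.
        rewrite mulrA ler_pdivrMr//.
        move: hM.
        by rewrite -(ler_nat R) !natrM; clear; lra.
      by clear; lra.
    have -> : rho ^+ (r + r) / 4 = (m%:R ^+ (r + r) / 2 / M%:R ^+ (r + r)) * 2^-1.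
      rewrite /rho expr_div_n; set a := _ ^+ _; set b := _ ^+ _.
      by field; rewrite gt_eqF// exprn_gt0.
    apply: ler_pM => //.
    by rewrite ler_wpM2r// invr_ge0 exprn_ge0.
  apply: le_trans (expect_open_paths i x n0 hc).
  have h3 : n%:R ^+ r / 2 <= #|@avoiding n r i|%:R :> R.
    rewrite card_avoiding; apply: (@le_trans _ _ ((n - r.+1) ^ r)%:R).
      apply: exp_sub_half => //; apply: leq_trans hn3; rewrite leq_pmull//.
      by rewrite muln_gt0.
    rewrite ler_nat; apply: leq_trans (expn_sub_ffact _ _).
    by rewrite leq_exp2r// -subn1 -subnDA add1n.
  have h4 : (n%:R ^+ r / 2) ^+ 2 <= (#|@avoiding n r i| ^ 2)%:R :> R.
    by rewrite natrX lerXn2r ?nnegrE ?divr_ge0 ?exprn_ge0.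
  have -> : lam ^+ (r + r) / 16 = rho ^+ (r + r) / 4 * (n%:R ^+ r / 2) ^+ 2.
    by rewrite /lam exprMn (exprD n%:R); set a := _ ^+ r; set b := rho ^+ _; field.
  by rewrite ler_wpM2l// divr_ge0// exprn_ge0.
- apply: (@expect_open_paths_sqr _ _ _ _ _ i x) => // z.
  have := @overlap_numeric R n r rho lam0 rho0 lam1 lam0lam r0.
  rewrite -/lam -/C; set S := (X in _ -> n%:R ^+ r * X <= _) => hS.
  apply: (@le_trans _ _ (n%:R ^+ r * S)); last exact: hS.
  apply: (@le_trans _ _ (\sum_(d in @avoiding n r i) S)).
    apply: ler_sum => d /avoidingP[dI _].
    apply: le_trans (overlap_sum _ _ dI); last by rewrite rho0 rho1.
    rewrite big_mkcond [leRHS]big_mkcond/=; apply: ler_sum => d' _.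
    rewrite inE; case: (injectiveb d') => //=; case: ifP => // _.
    by rewrite exprn_ge0.
  have S0 : 0 <= S.
    by apply: addr_ge0; apply: sumr_ge0 => k _; rewrite !mulr_ge0 ?exprn_ge0.
  rewrite sumr_const -[leLHS]mulr_natl ler_wpM2r//.
  rewrite card_avoiding -natrX ler_nat.
  apply: (@leq_trans (n.-1 ^ r)); last by rewrite leq_exp2r// leq_pred.
  rewrite ffact_prod -[X in (_ <= _ ^ X)%N]card_ord -prod_nat_const.
  by apply: leq_prod => j _; rewrite leq_subr.
Qed.

End BigPairs.

(** * Expected numbers of junctions and splits *)

Section Rates.
Context {R : realType} {n : nat}.
Hypothesis n_gt0 : (0 < n)%N.
Implicit Types (x y z : cube n) (i : 'I_n) (e : edge n) (w : seq (edge n)).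

Definition join_prob t : R := expect t (fun w : seq (edge n) =>
  average (fun e => (~~ joined (cluster_of w) e)%:R)).

Definition split_prob t : R := expect t (fun w : seq (edge n) =>
  average (fun e => (joined (porbit (stir w)) e)%:R)).

Let M0 := card_edges_gt0 n_gt0.

Lemma join_prob_ge0 t : 0 <= join_prob t.
Proof.
by rewrite /join_prob; apply: expect_ge0 => w _; apply: average_ge0.
Qed.

Lemma join_probS t : join_prob t.+1 <= join_prob t.
Proof.
rewrite /join_prob [leLHS]/=; apply: expect_le => w _.
rewrite -[leRHS](average_cst _ M0).
apply: average_le => e'; apply: average_le => e; rewrite ler_nat.
case: (boolP (joined (cluster_of w) e)) => [/(joined_cluster_cons e') -> //|_].
by case: (joined _ _).
Qed.

(** Clusters only grow, so an edge that is inside a cluster stays inside one. *)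
Lemma join_prob_le s t : (s <= t)%N -> join_prob t <= join_prob s.
Proof.
move=> /subnK <-; elim: (t - s)%N => // k; exact/le_trans/join_probS.
Qed.

Lemma expect_nb_clustersS t :
  expect t.+1 (fun w : seq (edge n) => nb_clusters w)
  = expect t (fun w : seq (edge n) => nb_clusters w) - join_prob t :> R.
Proof.
rewrite -expectB /=; apply: eq_expect => w _.
rewrite (eq_average (fun e => nb_clusters_cons e w)).
by rewrite /average sumrB mulrBl sumr_const -[_ *+ _]mulr_natr mulfK// pnatr_eq0 -lt0n.
Qed.

Lemma sum_join_prob t :
  \sum_(s < t) join_prob s
  = (2 ^ n)%:R - expect t (fun w : seq (edge n) => nb_clusters w).
Proof.
elim: t => [|t IH]; first by rewrite big_ord0 /= nb_clusters_nil subrr.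
by rewrite big_ord_recr IH expect_nb_clustersS /=; lra.
Qed.

(** Each junction removes a cluster, and there are [2 ^ n] of them at the start. *)
Lemma sum_join_prob_le t : \sum_(s < t) join_prob s <= (2 ^ n)%:R.
Proof.
rewrite sum_join_prob lerBlDr lerDl.
by apply: expect_ge0 => w _; exact: nb_clusters_ge0.
Qed.

Lemma expect_nb_cyclesS t :
  expect t.+1 (fun w : seq (edge n) => nb_cycles (stir w))
  = expect t (fun w : seq (edge n) => nb_cycles (stir w))
    + 2 * split_prob t - 1 :> R.
Proof.
transitivity (expect t (fun w : seq (edge n) => nb_cycles (stir w)
    + 2 * average (fun e => (joined (porbit (stir w)) e)%:R) - 1) : R).
  rewrite [LHS]/=; apply: eq_expect => w _.
  rewrite (eq_average (fun e => nb_cycles_cons e w)).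
  rewrite -averageZ -{2}(average_cst (nb_cycles (stir w)) M0) -averageD.
  by rewrite -[X in _ - X](average_cst 1 M0) /average sumrB mulrBl.
by rewrite expectB expectD expectZ expect_cst.
Qed.

Lemma expect_nb_fragments L t : (0 < L)%N ->
  expect t (fun w : seq (edge n) => nb_fragments L w)
  <= t%:R * (8 * log2 (2 * L)%:R / n%:R) :> R.
Proof.
move=> L0; elim: t => [|t IH]; first by rewrite /= nb_fragments_nil mul0r.
apply: (@le_trans _ _ (expect t (fun w : seq (edge n) =>
    nb_fragments L w + 8 * log2 (2 * L)%:R / n%:R))); last first.
  rewrite expectD expect_cst//; move: (8 * _ / _) IH => c IH.
  by rewrite -[t.+1%:R]natr1 mulrDl mul1r lerD2r.
rewrite [leLHS]/=; apply: expect_le => w _.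
apply: (@le_trans _ _
  (average (fun e => nb_fragments L w + 2 * (short_split L w e)%:R))).
  by apply: average_le => e; exact: nb_fragments_cons.
rewrite averageD average_cst// averageZ lerD2l.
by have := @average_short_split R n L w L0 n_gt0; lra.
Qed.

(** The number of cycles changes by [2 * split - 1] at each step. Over the window
    it cannot drop below the number of clusters at the end, and at the beginning
    it exceeds the number of clusters by little. *)
Lemma sum_split_prob L T T' : (0 < L)%N -> (T <= T')%N ->
  (T' - T)%:R - \sum_(T <= t < T') join_prob t
   - ((2 ^ n)%:R / L%:R + T%:R * (8 * log2 (2 * L)%:R / n%:R))
  <= 2 * \sum_(T <= t < T') split_prob t.
Proof.
move=> L0 TT'.
pose K t : R := expect t (fun w : seq (edge n) => nb_clusters w).
pose Y t : R := expect t (fun w : seq (edge n) => nb_cycles (stir w)).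
have KE : \sum_(T <= t < T') join_prob t = K T - K T'.
  rewrite -[RHS]opprB -(telescope_sumr K TT') -sumrN; apply: eq_bigr => t _.
  by rewrite /K expect_nb_clustersS; lra.
have YE : 2 * \sum_(T <= t < T') split_prob t = Y T' - Y T + (T' - T)%:R.
  rewrite -(telescope_sumr Y TT') -[(T' - T)%:R]sumr_const_nat -big_split/= mulr_sumr.
  by apply: eq_bigr => t _; rewrite /Y expect_nb_cyclesS; lra.
have KY : K T' <= Y T' by apply: expect_le => w _; exact: nb_clusters_le_cycles.
have YT : Y T <= K T + ((2 ^ n)%:R / L%:R + T%:R * (8 * log2 (2 * L)%:R / n%:R)).
  apply: (@le_trans _ _ (expect T (fun w : seq (edge n) =>
     nb_clusters w + (2 ^ n)%:R / L%:R + nb_fragments L w))).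
    by apply: expect_le => w _; exact: nb_cycles_le.
  by rewrite !expectD expect_cst// -addrA lerD2l lerD2l expect_nb_fragments.
by rewrite KE YE; lra.
Qed.

Definition touched w : {set cube n} := \bigcup_(e <- w) val e.

Lemma touched_card w : (#|touched w| <= 2 * size w)%N.
Proof.
rewrite /touched; elim: w => [|e w IH]; first by rewrite big_nil cards0.
rewrite big_cons; apply: leq_trans (leq_card_setU _ _) _.
rewrite /= mulnS leq_add//; have [x [i ->]] := edgeP e.
by rewrite cards2; case: (_ == _).
Qed.

Lemma cluster_untouched w x : x \notin touched w -> cluster_of w x = [set x]%SET.
Proof.
elim: w x => //= e w IH x; rewrite /touched big_cons inE negb_or => /andP[xe xw].
have pc := cluster_partitioning w.
rewrite /fuse IH//; case: ifP => // /finset.bigcupP[u ue].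
rewrite (partitioning_sym _ _ pc) IH// inE => /eqP ux.
by rewrite -ux ue in xe.
Qed.

(** An edge inside a cluster has both ends among the at most [2 * t] vertices that
    were touched before. *)
Lemma join_prob_ge t : 1 - (2 * t)%:R / (2 ^ n)%:R <= join_prob t.
Proof.
rewrite -[leLHS](expect_cst t _ M0); apply: expect_le => w wt.
have N0 : (0 : R) < (2 ^ n)%:R by rewrite ltr0n expn_gt0.
have n0R : (0 : R) < n%:R by rewrite ltr0n.
have -> : average (fun e => (~~ joined (cluster_of w) e)%:R)
   = 1 - average (fun e => (joined (cluster_of w) e)%:R) :> R.
  rewrite -[X in X - _](average_cst 1 M0) -[X in _ + X]mulN1r -averageZ -averageD.
  by apply: eq_average => e; case: (joined _ _); rewrite ?mulr1 ?mulr0 ?subrr ?subr0 ?addr0.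
rewrite lerD2l lerN2 average_edges ler_pdivrMr ?mulr_gt0//.
have -> : (2 * t)%:R / (2 ^ n)%:R * ((2 ^ n)%:R * n%:R) = (2 * t)%:R * n%:R :> R.
  by rewrite mulrA mulfVK// gt_eqF.
apply: (@le_trans _ _ (\sum_(x in touched w) n%:R)); last first.
  by rewrite sumr_const -[leLHS]mulr_natl ler_wpM2r// ler_nat -wt touched_card.
rewrite [leRHS]big_mkcond/=; apply: ler_sum => x _.
case: ifP => [_|/negbT xt].
  have <- : \sum_(i < n) 1 = n%:R :> R by rewrite sumr_const card_ord.
  by apply: ler_sum => i _; case: (joined _ _).
rewrite big1// => i _; rewrite joined_of; last exact: cluster_partitioning.
by rewrite (cluster_untouched xt) inE eq_sym (negbTE (flip_neq _ _)).
Qed.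

Definition big_pair L w e : bool := [forall x in val e, (L <= #|cluster_of w x|)%N].

Lemma big_pair_of L w x i : big_pair L w (edge_of x i)
  = (L <= #|cluster_of w x|)%N && (L <= #|cluster_of w (flip i x)|)%N.
Proof.
apply/forall_inP/andP => [h|[h1 h2] z].
  by split; apply: h; rewrite !inE eqxx ?orbT.
by rewrite !inE => /orP[] /eqP ->.
Qed.

Definition big_prob L t : R := expect t (fun w : seq (edge n) =>
  average (fun e => (big_pair L w e)%:R)).

Lemma big_pair_cons L w e e' : big_pair L w e -> big_pair L (e' :: w) e.
Proof.
move=> /forall_inP h; apply/forall_inP => x /h hx; apply: leq_trans hx _.
exact/subset_leq_card/sub_cluster_cons.
Qed.

Lemma big_probS L t : big_prob L t <= big_prob L t.+1.
Proof.
rewrite /big_prob [leRHS]/=; apply: expect_le => w _.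
rewrite -[leLHS](average_cst _ M0).
apply: average_le => e'; apply: average_le => e; rewrite ler_nat.
by case: (boolP (big_pair L w e)) => [/(@big_pair_cons L w e e') -> //|].
Qed.

Lemma big_prob_le L s t : (s <= t)%N -> big_prob L s <= big_prob L t.
Proof.
move=> /subnK <-; elim: (t - s)%N => // k h; exact: le_trans h (big_probS _ _).
Qed.

(** The number of clusters, where a cluster of size [k < L] counts only for
    [k / L]: it is at most [2 ^ n / L], cannot increase, and loses one whenever
    two clusters of size at least [L] merge. *)
Definition truncated_count L w : R :=
  class_sum (fun A => Num.min 1 (#|A|%:R / L%:R)) (cluster_of w).

Lemma truncated_count_ge0 L w : 0 <= truncated_count L w.
Proof. by apply: sumr_ge0 => z _; rewrite divr_ge0// le_min ler01 divr_ge0. Qed.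

Lemma truncated_count_le L w : (0 < L)%N ->
  truncated_count L w <= (2 ^ n)%:R / L%:R.
Proof.
move=> L0.
have -> : (2 ^ n)%:R / L%:R = \sum_(z : cube n) L%:R^-1 :> R.
  by rewrite sumr_const card_cube -[RHS]mulr_natl.
apply: ler_sum => z _; have z0 : (0 < #|cluster_of w z|)%N.
  by apply/card_gt0P; exists z; exact: (cluster_partitioning w).1.
by rewrite ler_pdivrMr ?ltr0n// mulrC ge_min lexx orbT.
Qed.

Lemma truncated_count_cons L w e : (0 < L)%N ->
  truncated_count L (e :: w)
  <= truncated_count L w - ((big_pair L w e)%:R - (joined (cluster_of w) e)%:R).
Proof.
move=> L0; have pc := cluster_partitioning w.
have LR : (0 : R) < L%:R by rewrite ltr0n.
have [j|] := boolP (joined (cluster_of w) e).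
  rewrite /truncated_count (eq_class_sum _ (cluster_cons_joined j)).
  by rewrite lerDl opprB subr_ge0; case: (big_pair _ _ _).
have [x [i ->]] := edgeP e; rewrite joined_of// => xj.
rewrite /truncated_count /= class_sum_fuse// subr0.
rewrite -!addrA lerD2l big_pair_of.
set A := cluster_of w x; set B := cluster_of w (flip i x).
have cAB : (#|A :|: B| = #|A| + #|B|)%N.
  by rewrite cardsU finset.disjoint_setI0 ?cards0 ?subn0//; exact: partitioning_disjoint.
have sub (a b : R) : 0 <= a -> 0 <= b ->
    Num.min 1 (a + b) <= Num.min 1 a + Num.min 1 b.
  clear=> a0 b0; rewrite !minEle; case: (leP 1 (a + b)); case: (leP 1 a);
    case: (leP 1 b) => *; lra.
have AB0 : 0 <= #|A|%:R / L%:R :> R by rewrite divr_ge0.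
have BB0 : 0 <= #|B|%:R / L%:R :> R by rewrite divr_ge0.
have one (k : nat) : (L <= k)%N -> Num.min 1 (k%:R / L%:R) = 1 :> R.
  by move=> Lk; apply/min_idPl; rewrite ler_pdivlMr// mul1r ler_nat.
have [/andP[LA LB]|_] := boolP ((L <= #|A|)%N && (L <= #|B|)%N).
  rewrite (one _ LA) (one _ LB) one; last by rewrite cAB (leq_trans LA)// leq_addr.
  by rewrite mulr1n; lra.
by rewrite cAB natrD mulrDl; have := sub _ _ AB0 BB0; rewrite mulr0n; lra.
Qed.

Definition trunc_mean L t : R :=
  expect t (fun w : seq (edge n) => truncated_count L w).

(** At a time [t] between [m] and [T], an edge joins two distinct big clusters with
    probability at least [big_prob L t - (1 - join_prob t)]. As [big_prob L]
    increases and [join_prob] decreases, this is at least the factor on the left;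
    and [truncated_count] pays one for each such junction. *)
Lemma big_prob_join L m T : (0 < L)%N -> (m <= T)%N ->
  (T - m)%:R * (big_prob L m - (1 - join_prob T)) <= (2 ^ n)%:R / L%:R.
Proof.
move=> L0 mT.
have step t : trunc_mean L t.+1
    <= trunc_mean L t - (big_prob L t - (1 - join_prob t)).
  rewrite /trunc_mean /big_prob /join_prob -[X in X - expect t _](expect_cst t 1 M0).
  rewrite -!expectB [leLHS]/=; apply: expect_le => w _.
  apply: le_trans (average_le (fun e => truncated_count_cons w e L0)) _.
  rewrite -[X in X - average _](average_cst 1 M0).
  rewrite -[X in X - (_ - (_ - _))](average_cst (truncated_count L w) M0).
  rewrite /average -!mulrBl -!sumrB ler_pM2r ?invr_gt0 ?ltr0n// ler_sum// => e _.
  by case: (joined _ _) => /=; rewrite ?mulr1n ?mulr0n; lra.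
have sum : \sum_(m <= t < T) (big_prob L t - (1 - join_prob t))
    <= trunc_mean L m - trunc_mean L T.
  rewrite -[leRHS]opprB -(telescope_sumr (trunc_mean L) mT) -sumrN.
  by apply: ler_sum => t _; have := step t; lra.
apply: (@le_trans _ _ (\sum_(m <= t < T) (big_prob L t - (1 - join_prob t)))).
  rewrite mulr_natl -sumr_const_nat.
  rewrite big_nat [leRHS]big_nat; apply: ler_sum => t /andP[mt tT].
  by have := big_prob_le L mt; have := join_prob_le (ltnW tT); lra.
apply: le_trans sum _.
have h1 : trunc_mean L m <= (2 ^ n)%:R / L%:R.
  rewrite -[leRHS](expect_cst m _ M0); apply: expect_le => w _.
  exact: truncated_count_le.
have h2 : 0 <= trunc_mean L T.
  by apply: expect_ge0 => w _; exact: truncated_count_ge0.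
lra.
Qed.

End Rates.

(** * Junctions are not almost certain after time cN *)

Section Slack.
Context {R : realType}.
Implicit Types (c : R).

Lemma nat_above (x : R) : exists j : nat, x < j%:R.
Proof.
exists (Num.truncn `|x|).+1; apply: le_lt_trans (ler_norm x) _.
by case/andP: (truncn_itv (normr_ge0 x)).
Qed.

Lemma nat_lt_exp2 (j : nat) : j%:R < (2 ^ j)%:R :> R.
Proof. by rewrite ltr_nat ltn_expl. Qed.

(** At most [2 ^ n] junctions occur before time [T], and their probability
    decreases, so it is at most [2 ^ n / T < 1 / c] at time [T]. The inequality is
    strict by a fixed amount because during the first [kap * 2 ^ n] steps the
    probability of a junction is close to [1]. *)
Lemma join_prob_counting c : 1 < c ->
  exists2 s : R, 0 < s & exists n1, forall n T, (n1 <= n)%N -> (0 < n)%N ->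
    c * (2 ^ n)%:R < T%:R -> @join_prob R n T <= 1 / c - s.
Proof.
move=> c1; have c0 : 0 < c by lra.
(* a power of two for [kap] makes [kap * 2 ^ n] an integer *)
have [j hj] := nat_above (2 * c / (c - 1)).
have hj2 := lt_trans hj (nat_lt_exp2 j).
pose kap : R := (2 ^ j)%:R^-1.
have P0 : (0 : R) < (2 ^ j)%:R by rewrite ltr0n expn_gt0.
have kap0 : 0 < kap by rewrite invr_gt0.
have hk : 2 * c * kap < c - 1.
  move: hj2; rewrite ltr_pdivrMr ?subr_gt0// => h.
  by rewrite /kap ltr_pdivrMr// [ltRHS]mulrC.
have kc : 0 < c - kap by nra.
exists (1 / c - (1 - kap + 2 * kap ^+ 2) / (c - kap)).
  rewrite subr_gt0 ltr_pdivrMr// mulrAC ltr_pdivlMr//; nra.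
exists j => n T jn n0 cT.
have N0 : (0 : R) < (2 ^ n)%:R by rewrite ltr0n expn_gt0.
pose k := (2 ^ (n - j))%N.
have kE : k%:R = kap * (2 ^ n)%:R :> R.
  by rewrite /k /kap -{2}(subnK jn) expnD natrM mulrC mulfK// gt_eqF.
have kT : (k <= T)%N.
  by rewrite -(ler_nat R) kE ltW// (le_lt_trans _ cT)// ler_wpM2r//; nra.
have sumle := @sum_join_prob_le R n n0 T.
have p0 := @join_prob_ge0 R n T.
rewrite opprB addrCA subrr addr0 ler_pdivlMr//.
move: (join_prob_le n0 (R := R)) (join_prob_ge n0 (R := R)) p0 sumle.
set p := join_prob; move=> mono ge p0 sumle.
have low : k%:R * (1 - 2 * kap) + (T%:R - k%:R) * p T <= (2 ^ n)%:R.
  apply: le_trans sumle; rewrite -(big_mkord xpredT p) (big_cat_nat (leq0n k) kT)/=.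
  rewrite -(natrB _ kT) lerD//.
    rewrite mulr_natl -{1}(subn0 k) -sumr_const_nat [leLHS]big_nat [leRHS]big_nat.
    apply: ler_sum => t /andP[_ tk]; apply: le_trans (ge t).
    rewrite lerD2l lerN2 ler_pdivrMr// -mulrA -kE natrM ler_pM2l// ler_nat.
    exact: ltnW.
  rewrite mulr_natl -sumr_const_nat [leLHS]big_nat [leRHS]big_nat.
  by apply: ler_sum => t /andP[_ tT]; apply: mono; apply: ltnW.
have : (c - kap) * (2 ^ n)%:R * p T <= (T%:R - k%:R) * p T.
  by rewrite ler_wpM2r// mulrBl -kE lerD2r ltW.
move: low; rewrite kE => low up.
rewrite -(ler_pM2r N0); move: low up; set N := (2 ^ n)%:R; set q := p T.
by move=> low up; nra.
Qed.

(** At time [m], about [c1 * 2 ^ n] with [c1 > 1 / 2], both ends of an edge are in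
    clusters of size at least [L] with probability [q], whatever [L]. If the edges
    inside a cluster had probability less than [q / 2] until time [T],
    [big_prob_join] would bound [T - m] by a multiple of [2 ^ n / L], which is
    false when [L] is large. *)
Lemma join_prob_percolation c : 1 / 2 < c ->
  exists2 s : R, 0 < s & exists n1, forall n T, (n1 <= n)%N -> (0 < n)%N ->
    c * (2 ^ n)%:R < T%:R -> @join_prob R n T <= 1 - s.
Proof.
move=> c12.
(* [c <= 1] may be assumed, which keeps the density of open edges bounded *)
pose c' : R := Num.min c 1.
have c'12 : 1 / 2 < c' by rewrite lt_min c12/=; lra.
have c'1 : c' <= 1 by rewrite ge_min lexx orbT.
have c'c : c' <= c by rewrite ge_min lexx.
pose gap : R := (c' - 1 / 2) / 2.
have gap0 : 0 < gap by rewrite /gap; lra.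
pose c1 : R := 1 / 2 + gap.
have c1_gt0 : 0 < c1 by rewrite /c1; lra.
pose lam0 : R := 2 * c1.
have lam1 : 1 < lam0 by rewrite /lam0 /c1; lra.
pose q : R := pair_constant lam0.
have q0 : 0 < q.
  rewrite /q /pair_constant invr_gt0 exprn_gt0// mulr_gt0// addr_gt0// divr_gt0//; lra.
have [L0 hL0] := nat_above (4 / (q * gap)).
pose L := L0.+1.
have hL : 4 / (q * gap) < L%:R by apply: lt_trans hL0 _; rewrite ltr_nat.
have LR : (0 : R) < L%:R by rewrite ltr0n.
have [n1 big] := prob_both_big lam1 (ltn0Sn L0).
have [n2 hn2] := nat_above (4 / gap).
exists (q / 2); first by rewrite divr_gt0.
exists (n1 + n2)%N => n T nn n0 cT.
have N0 : (0 : R) < (2 ^ n)%:R by rewrite ltr0n expn_gt0.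
have Nbig : 4 < gap * (2 ^ n)%:R.
  move: hn2; rewrite ltr_pdivrMr// mulrC => h; apply: lt_trans h _.
  rewrite ltr_pM2l// ; apply: le_lt_trans (nat_lt_exp2 n).
  by rewrite ler_nat (leq_trans _ nn)// leq_addl.
pose m := (Num.truncn (c1 * (2 ^ n)%:R)).+1.
have /andP[m1 m2] : (Num.truncn (c1 * (2 ^ n)%:R))%:R <= c1 * (2 ^ n)%:R < m%:R.
  by apply: truncn_itv; apply: mulr_ge0 => //; exact: ltW.
have m3 : m%:R <= c1 * (2 ^ n)%:R + 1 by rewrite /m -natr1 lerD2r.
have c'T : c' * (2 ^ n)%:R < T%:R.
  by apply: le_lt_trans cT; rewrite ler_wpM2r.
have mT : m%:R + gap / 2 * (2 ^ n)%:R <= T%:R.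
  apply: (le_trans _ (ltW c'T)).
  apply: (le_trans (_ : _ <= c1 * (2 ^ n)%:R + 1 + gap / 2 * (2 ^ n)%:R)).
    by rewrite lerD2r.
  have -> : c' = c1 + gap by rewrite /c1 /gap; field.
  by rewrite (mulrDl c1 gap); lra.
have mTn : (m <= T)%N.
  by rewrite -(ler_nat R); apply: le_trans mT; rewrite lerDl mulr_ge0// divr_ge0// ltW.
have mN : (m <= 2 ^ n)%N.
  rewrite -(ler_nat R); apply: (le_trans m3).
  have e : c' = c1 + gap by rewrite /c1 /gap; field.
  have : 0 <= (1 - c1 - gap) * (2 ^ n)%:R by rewrite mulr_ge0//; lra.
  by rewrite !mulrBl mul1r; lra.
have bigq : q <= @big_prob R n L m.
  rewrite /big_prob expect_average -[leLHS](average_cst _ (card_edges_gt0 n0)).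
  apply: average_le => e; have [x [i ->]] := edgeP e.
  rewrite (eq_expect (fun w _ => congr1 (fun b : bool => b%:R) (big_pair_of L w x i))).
  apply: big => //; first by apply: leq_trans nn; rewrite leq_addr.
  by rewrite /lam0 -mulrA ler_pM2l// ltW.
have J := @big_prob_join R n n0 L m T (ltn0Sn _) mTn.
move: J bigq; set b := big_prob L m; set p := join_prob T => J bq.
rewrite leNgt; apply/negP => hp.
have h1 : gap / 2 * (2 ^ n)%:R <= (T - m)%:R by rewrite natrB//; lra.
have h2 : q / 2 <= b - (1 - p) by lra.
have h3 : gap / 2 * (2 ^ n)%:R * (q / 2) <= (2 ^ n)%:R / L%:R.
  apply: le_trans J; apply: ler_pM => //; last by rewrite divr_ge0// ltW.
  by rewrite mulr_ge0// divr_ge0// ltW.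
move: h3; rewrite ler_pdivlMr// => h3.
have h4 : 4 < L%:R * (q * gap) by rewrite -ltr_pdivrMr// mulr_gt0.
have : (2 ^ n)%:R * 4 < (2 ^ n)%:R * (L%:R * (q * gap)) by rewrite ltr_pM2l.
move: h3; set N := (2 ^ n)%:R; set l := L%:R => h3.
have -> : N * (l * (q * gap)) = 4 * (gap / 2 * N * (q / 2) * l) by field.
by move: h3; clear; lra.
Qed.

(** For [1 < c] the counting argument gives the explicit value of [eta]; below, the
    percolation argument gives some positive value. The slack [s] absorbs the error
    terms. *)
Lemma slack_exists c : 1 / 2 < c ->
  exists eta s : R, [/\ 0 < eta, 0 < s, (1 < c -> eta = 1 / 2 * (1 - 1 / c)) &
    exists n1, forall n T, (n1 <= n)%N -> (0 < n)%N ->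
    c * (2 ^ n)%:R < T%:R -> @join_prob R n T <= 1 - 2 * eta - s].
Proof.
move=> c12; have [c1|c1] := ltP 1 c.
  have [s s0 [n1 h]] := join_prob_counting c1.
  exists (1 / 2 * (1 - 1 / c)), s; split => //.
    by rewrite mulr_gt0// subr_gt0 ltr_pdivrMr ?mul1r//; lra.
  exists n1 => n T nn n0 cT; apply: le_trans (h n T nn n0 cT) _.
  by lra.
have [s s0 [n1 h]] := join_prob_percolation c12.
exists (s / 4), (s / 2).
split; [by rewrite divr_gt0|by rewrite divr_gt0|by move=> c1'; exfalso; lra|].
exists n1 => n T nn n0 cT; apply: le_trans (h n T nn n0 cT) _.
by lra.
Qed.

End Slack.

Local Open Scope classical_set_scope.
Local Open Scope ring_scope.

(** * The lower bound for uniform histories *)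

Section FiniteStatement.
Context {R : realType}.
Implicit Types (c a : R).

Definition long_mean n (l : R) t : R := expect t (fun w : seq (edge n) =>
  #|long_cycle_vertices (stir w) l|%:R / (2 ^ n)%:R).

Lemma split_prob_le n a t : (0 < n)%N -> 0 < a ->
  @split_prob R n t <= long_mean n ((2 ^ n)%:R `^ a) t + a.
Proof.
move=> n0 a0; have M0 := card_edges_gt0 n0.
have nR : (0 : R) < n%:R by rewrite ltr0n.
rewrite -[X in _ + X](expect_cst t a M0) -expectD; apply: expect_le => w _.
have l1 : 1 <= (2 ^ n)%:R `^ a :> R.
  have := @ler_powR R (2 ^ n)%:R _ _ _ (ltW a0).
  by rewrite powRr0 ler1n expn_gt0; apply.
apply: le_trans (average_split _ l1 n0) _; rewrite lerD2l.
rewrite /log2 ln_powR natrX lnXn// ler_pdivrMr// ler_pdivrMr ?ln2_gt0//.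
by rewrite -[ln 2 *+ n]mulr_natl mulrA.
Qed.

(** Combine [split_prob_le] and [sum_split_prob], with the short cycles cut at
    length [n]. The errors are all of order [u = T * log2 n / n], which is small
    compared with [D * s] by the growth assumption on [Delta]. *)
Lemma finite_bound c : 1 / 2 < c ->
  exists eta : R, [/\ 0 < eta, (1 < c -> eta = 1 / 2 * (1 - 1 / c)) &
    forall Delta : nat -> R, (forall n, 0 < Delta n) ->
      (fun n : nat => Delta n * n%:R / log2 n%:R) @ \oo --> +oo ->
      exists n0 : nat, forall (n T : nat) (a : R),
        (n0 < n)%N -> c * (2 ^ n)%:R < T%:R -> 0 < a ->
        eta - a <= (Delta n * T%:R)^-1 *
           \sum_(T.+1 <= t < (Num.truncn ((1 + Delta n) * T%:R)).+1)
             long_mean n ((2 ^ n)%:R `^ a) t].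
Proof.
move=> c12; have [eta [s [eta0 s0 etaE [n1 slack]]]] := slack_exists c12.
exists eta; split => // Delta Delta0 /cvgryPge Dlarge.
(* [34 * u] bounds the excess of cycles, and [2 * (2 * eta + s) * u]
   the loss of one term in the rounding of the window *)
have [n2 _ hn2] := Dlarge ((34 + 2 * (2 * eta + s)) / s).
exists (n1 + n2 + 2)%N => n T a hn cT a0.
have nn1 : (n1 <= n)%N by apply: leq_trans (ltnW hn); rewrite -addnA leq_addr.
have nn2 : (n2 <= n)%N.
  by apply: leq_trans (ltnW hn); rewrite addnAC leq_addl.
have n2' : (2 <= n)%N by apply: leq_trans (ltnW hn); rewrite leq_addl.
have n0 : (0 < n)%N by apply: ltnW.
have nR : (0 : R) < n%:R by rewrite ltr0n.
have N0 : (0 : R) < (2 ^ n)%:R by rewrite ltr0n expn_gt0.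
have nN : n%:R < (2 ^ n)%:R :> R by exact: nat_lt_exp2.
have T0 : (0 : R) < T%:R by apply: lt_trans cT; rewrite mulr_gt0//; lra.
have NT : (2 ^ n)%:R <= 2 * T%:R :> R.
  have : 1 / 2 * (2 ^ n)%:R <= c * (2 ^ n)%:R by rewrite ler_wpM2r// ltW.
  lra.
set De := Delta n; have De0 : 0 < De by exact: Delta0.
set x := (1 + De) * T%:R.
have x0 : 0 <= x by rewrite mulr_ge0// addr_ge0// ltW.
have /andP[tx xt] := truncn_itv x0.
set T' := Num.truncn x in tx xt *.
have TT' : (T <= T')%N.
  rewrite -ltnS -(ltr_nat R); apply: le_lt_trans xt.
  by rewrite /x mulrDl mul1r lerDl mulr_ge0// ltW.
set D := De * T%:R; have D0 : 0 < D by rewrite mulr_gt0.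
have dD : (T' - T)%:R <= D.
  by rewrite natrB//; move: tx; rewrite /x mulrDl mul1r -/D; lra.
have Dd : D - 1 <= (T' - T)%:R.
  by rewrite natrB//; move: xt; rewrite /x mulrDl mul1r -/D -natr1; lra.
set V := \sum_(_ <= t < _) _.
have sV : \sum_(T.+1 <= t < T'.+1) @split_prob R n t <= V + (T' - T)%:R * a.
  rewrite mulr_natl -(subSS T T') -sumr_const_nat -big_split/=.
  by apply: ler_sum => t _; exact: split_prob_le.
have sJ : \sum_(T.+1 <= t < T'.+1) @join_prob R n t
    <= (T' - T)%:R * (1 - 2 * eta - s).
  rewrite mulr_natl -(subSS T T') -sumr_const_nat [leLHS]big_nat [leRHS]big_nat.
  apply: ler_sum => t /andP[Tt _]; apply: le_trans (slack n T nn1 n0 cT).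
  by apply: join_prob_le => //; exact: ltnW.
(* fragments are the cycles shorter than the dimension [n] *)
have := @sum_split_prob R n n0 n T.+1 T'.+1 n0 TT'.
rewrite subSS; set exc := (X in _ - X <= _) => main.
set lg : R := log2 n%:R.
have lg1 : 1 <= lg by rewrite -log2_2; apply: log2_le => //; rewrite ler_nat.
have lg2n : log2 (2 * n)%:R = 1 + lg by rewrite natrM log2M// log2_2.
pose u := T%:R * (lg / n%:R).
have lg0 : 0 < lg := lt_le_trans ltr01 lg1.
have u0 : 0 < u by rewrite mulr_gt0// divr_gt0.
have NTlg : (2 ^ n)%:R <= 2 * T%:R * lg.
  by apply: (le_trans NT); rewrite ler_peMr// mulr_ge0// ltW.
have excu : exc <= 34 * u.
  have h1 : (2 ^ n)%:R / n%:R <= 2 * u.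
    by rewrite /u mulrA mulrA ler_pM2r ?invr_gt0.
  have h2 : T.+1%:R <= 2 * T%:R :> R.
    rewrite -natr1; have : (1 : R) <= T%:R by rewrite ler1n -(ltr0n R).
    lra.
  have h3 : 8 * log2 (2 * n)%:R / n%:R <= 16 * (lg / n%:R).
    by rewrite mulrA ler_pM2r ?invr_gt0// lg2n; lra.
  have h4 : T.+1%:R * (8 * log2 (2 * n)%:R / n%:R) <= 2 * T%:R * (16 * (lg / n%:R)).
    apply: ler_pM => //; rewrite lg2n; apply: divr_ge0 => //.
    by apply: mulr_ge0 => //; lra.
  have -> : 34 * u = 2 * u + 2 * T%:R * (16 * (lg / n%:R)) by rewrite /u; ring.
  exact: lerD.
have u1 : 1 <= 2 * u.
  rewrite /u mulrA mulrA ler_pdivlMr// mul1r; exact: le_trans (ltW nN) NTlg.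
have Ds : (34 + 2 * (2 * eta + s)) * u <= D * s.
  have := hn2 n nn2; rewrite ler_pdivrMr// -/De -/lg => h.
  have -> : D * s = De * n%:R / lg * s * u.
    by rewrite /D /u; field; rewrite !gt_eqF//; lra.
  by rewrite ler_pM2r.
have fin : (eta - a) * D <= V.
  have k1 : (D - 1) * (eta + s / 2) <= (T' - T)%:R * (eta + s / 2).
    by rewrite ler_wpM2r//; lra.
  have k2 : (T' - T)%:R * a <= D * a by rewrite ler_wpM2r// ltW.
  have k3 : 2 * eta + s <= 2 * (2 * eta + s) * u.
    have : (2 * eta + s) * 1 <= (2 * eta + s) * (2 * u) by rewrite ler_wpM2l//; lra.
    lra.
  move: main sV sJ Ds excu k1 k2 k3.
  move: (\sum_(_ <= t < _) split_prob t) (\sum_(_ <= t < _) join_prob t) => S J.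
  move: (T' - T)%:R => d; lra.
by rewrite mulrC ler_pdivlMr.
Qed.

End FiniteStatement.

(** * From random edges to uniform histories *)

Section Histories.
Context {S : finType}.

Fixpoint history (X : nat -> S) t : seq S :=
  if t is t'.+1 then X t' :: history X t' else [::].

Lemma size_history X t : size (history X t) = t.
Proof. by elim: t => //= t ->. Qed.

(** The newest choice comes first, hence the reversed index. *)
Lemma history_eqP (s0 : S) X t (v : seq S) : size v = t ->
  history X t = v <-> (forall j, (j < t)%N -> X j = nth s0 v (t - j.+1)).
Proof.
elim: t v => [|t IH] [|s v]//= [vt]; split=> [[<- hv] j|h].
  rewrite ltnS leq_eqVlt => /orP[/eqP ->|jt]; first by rewrite subnn.
  by rewrite subSS -(subnSK jt)/=; apply: (IH v vt).1.
have -> : X t = s by have := h t (ltnSn t); rewrite subnn.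
congr cons; apply: (IH v vt).2 => j jt.
by have := h j (ltnW jt); rewrite subSS -(subnSK jt).
Qed.

Lemma expect_tuples {R : realType} t (F : seq S -> R) :
  expect t F = (\sum_(v : t.-tuple S) F v) / #|S|%:R ^+ t.
Proof.
elim: t F => [|t IH] F /=.
  rewrite expr0 divr1 (big_pred1 [tuple]) //= => v.
  by rewrite (tuple0 v); apply/esym/eqP.
rewrite IH exprS invfM mulrA; congr (_ / _).
rewrite /average -mulr_suml; congr (_ / _).
rewrite exchange_big/= pair_bigA/=.
rewrite (reindex (fun v : t.+1.-tuple S => (thead v, [tuple of behead v])))/=.
  by apply: eq_bigr => v _; rewrite [in RHS](tuple_eta v).
exists (fun p : S * t.-tuple S => [tuple of p.1 :: p.2]) => [v _|[s v] _] /=.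
  by rewrite [RHS]tuple_eta; apply: val_inj.
by rewrite theadE; congr pair; apply: val_inj.
Qed.

End Histories.

Section Bridge.
Context {d : measure_display} {Omega : measurableType d} {R : realType}.
Variables (P : probability Omega R) (S : finType) (s0 : S).
Variable X : nat -> Omega -> S.
Hypothesis iidX : iid_uniform P X.

Lemma history_preimage t (v : seq S) : size v = t ->
  [set w | history (fun k => X k w) t = v]
  = \bigcap_(j in [set` [fset j in iota 0 t]%fset])
      (X j @^-1` [set nth s0 v (t - j.+1)]).
Proof.
move=> vt; apply/seteqP; split => w /=.
  move=> /(history_eqP s0 _ vt) h j /=; rewrite inE mem_iota => /andP[_ jt].
  exact: h.
move=> h; apply/(history_eqP s0 _ vt) => j jt; apply: h => /=.
by rewrite inE mem_iota.
Qed.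

Lemma history_measurable t (v : seq S) : size v = t ->
  measurable [set w | history (fun k => X k w) t = v].
Proof.
move=> vt; rewrite history_preimage//; apply: fin_bigcap_measurable.
  exact: finite_fset.
by move=> j _; case: (iidX.1 j (nth s0 v (t - j.+1))).
Qed.

(** Independence for the finite set of times before [t]. *)
Lemma history_prob t (v : seq S) : size v = t ->
  P [set w | history (fun k => X k w) t = v] = ((#|S|%:R ^+ t)^-1)%:E.
Proof.
move=> vt; rewrite history_preimage//.
rewrite (iidX.2 [fset j in iota 0 t]%fset (fun j => [set nth s0 v (t - j.+1)])).
rewrite (eq_bigr (fun=> (#|S|%:R^-1)%:E)); last first.
  by move=> j _; case: (iidX.1 j (nth s0 v (t - j.+1))).
rewrite big_const_seq count_predT.
have -> : size [fset j in iota 0 t]%fset = t.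
  rewrite -[RHS](size_iota 0 t); apply/perm_size/uniq_perm; rewrite ?iota_uniq//.
  by move=> j; rewrite inE.
elim: (t) => [|k IH] /=; first by rewrite expr0 invr1.
by rewrite IH -EFinM exprS invfM.
Qed.

(** Only finitely many histories of length [t] exist, and they are equiprobable. *)
Lemma expectation_history t (F : seq S -> R) : (forall v, 0 <= F v) ->
  ('E_P[fun w => F (history (fun k => X k w) t)] = (expect t F)%:E)%E.
Proof.
move=> F0; rewrite unlock expect_tuples.
have XE w : (F (history (fun k => X k w) t))%:E
    = (\sum_(v : t.-tuple S) (F v)%:E
        * (\1_[set w | history (fun k => X k w) t = v] w)%:E)%E.
  have ht : size (history (fun k => X k w) t) == t by rewrite size_history.
  rewrite (bigD1 (Tuple ht))//= big1 ?adde0.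
    by rewrite indicE mem_set ?mule1.
  move=> v /eqP vh; rewrite indicE memNset ?mule0// => e; apply: vh.
  by apply: val_inj; rewrite /= e.
under eq_integral do rewrite XE.
rewrite ge0_integral_sum//.
- rewrite mulr_suml -sumEFin; apply: eq_bigr => v _.
  rewrite ge0_integralZl_EFin//.
  + rewrite integral_indic//; last exact/history_measurable/size_tuple.
    rewrite classical_sets.setIT EFinM; congr (_ * _)%E.
    exact/history_prob/size_tuple.
  + apply/measurable_EFinP; apply: measurable_indic.
    exact/history_measurable/size_tuple.
- move=> v; apply/measurable_EFinP; apply: measurable_funM => //.
  apply: measurable_indic; exact/history_measurable/size_tuple.
- by move=> v w _; rewrite mule_ge0// lee_fin.
Qed.

End Bridge.

Lemma stirring_perm_history n (w : nat -> edge n) t :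
  stirring_perm w t = stir (history w t).
Proof. by elim: t => //= t ->. Qed.

Theorem theorem2p2 (R : realType) (c : R) (c_gt : 1 / 2 < c) :
  exists eta : R,
    0 < eta /\
    (1 < c -> eta = 1 / 2 * (1 - 1 / c)) /\
    forall Delta : nat -> R,
      (forall n, 0 < Delta n) ->
      (fun n : nat => Delta n * n%:R / log2 n%:R) @ \oo --> +oo ->
      exists n0 : nat, forall (n T : nat) (a : R),
        (n0 < n)%N -> c * (2 ^ n)%:R < T%:R -> 0 < a ->
        forall (d : measure_display) (Omega : measurableType d)
               (P : probability Omega R) (e : nat -> Omega -> edge n),
          iid_uniform P e ->
          ((eta - a)%:E <=
           ((Delta n * T%:R)^-1)%:E *
           \sum_(T.+1 <= t < (Num.truncn ((1 + Delta n) * T%:R)).+1)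
             'E_P[fun w : Omega =>
                  (#|long_cycle_vertices
                      (stirring_perm (fun k => e k w) t)
                      (((2 ^ n)%:R : R) `^ a)|%:R / (2 ^ n)%:R)%R])%E.
Proof.
have [eta [eta0 etaE bound]] := finite_bound c_gt.
exists eta; split=> //; split=> // Delta Delta0 Dlarge.
have [n0 h] := bound Delta Delta0 Dlarge.
exists n0 => n T a hn cT a0 d Omega P e iide.
have n_gt0 : (0 < n)%N by apply: leq_ltn_trans hn.
have s0 : edge n := edge_of [ffun=> false] (Ordinal n_gt0).
rewrite (eq_bigr (fun t => (long_mean n ((2 ^ n)%:R `^ a) t)%:E)); last first.
  move=> t _; rewrite -(expectation_history s0 iide); last first.
    by move=> v; rewrite divr_ge0.
  by congr expectation; apply/funext => w; rewrite stirring_perm_history.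
by rewrite sumEFin -EFinM lee_fin; exact: h.
Qed.
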